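(* Let $\varrho=\frac12\delta_{-1}+\frac12\delta_1$ and let $0<\beta_n<\infty$ depend on $n$ in such a way that $\beta_n\to1$ monotonically as $n\to\infty$. Let $P_n=P_{n,\beta_n}$. Then the following assertions hold, where in each case $C$ denotes a constant not depending on $n$. (1) If $\beta_n-1=\frac{\gamma}{\sqrt n}$ for some $\gamma\ne0$, then $$\sup_{z\in\mathbb{R}}\Big|P_n\big(S_n/n^{3/4}\le z\big)-F_\gamma(z)\Big|\le C\,n^{-1/2},$$ where $F_\gamma(z):=\frac1Z\int_{-\infty}^z\exp\big(-\frac{x^4}{12}+\frac{\gamma x^2}{2}\big)\,dx$ and $Z:=\int_{\mathbb{R}}\exp\big(-\frac{x^4}{12}+\frac{\gamma x^2}{2}\big)\,dx$. (2) If $|\beta_n-1|\ll n^{-1/2}$, then $S_n/n^{3/4}$ converges in distribution to the law with distribution function $F(z):=\int_{-\infty}^z e^{-x^4/12}\,dx\big/\int_{\mathbb{R}}e^{-x^4/12}\,dx$. Moreover, if $|\beta_n-1|=\mathcal{O}(n^{-1})$, then $$\sup_{z\in\mathbb{R}}\Big|P_n\big(S_n/n^{3/4}\le z\big)-F(z)\Big|\le C\,n^{-1/2}.$$ (3) If $\beta_n<1$ and $|\beta_n-1|\gg n^{-1/2}$, then the Kolmogorov distance between the distribution of $\sqrt{\frac{1-\beta_n}{n}}\sum_{i=1}^nX_i$ under $P_n$ and the standard normal distribution $N(0,1)$ converges to zero. Moreover, if $\beta_n<1$ and $|\beta_n-1|\gg n^{-1/4}$, then $$\sup_{z\in\mathbb{R}}\Big|P_n\Big(\frac{\sqrt{1-\beta_n}\,S_n}{\sqrt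 n}\le z\Big)-\Phi(z)\Big|\le C\,n^{-1/2},$$ where $\Phi$ is the standard normal distribution function.
   Context: Classical Curie–Weiss model: for $\beta>0$ and $n\ge1$, $P_{n,\beta}$ is the probability measure on $\{-1,+1\}^n$ under which the spins $(X_1,\dots,X_n)$ have the law $$dP_{n,\beta}(x)=\frac{1}{Z_n(\beta)}\exp\Big(\frac{\beta}{2n}\big(\sum_{i=1}^n x_i\big)^2\Big)\prod_{i=1}^n d\varrho(x_i),$$ with normalizing constant $Z_n(\beta)$. $S_n=\sum_{i=1}^n X_i$. For positive sequences, $a_n\ll b_n$ means $a_n/b_n\to0$ and $a_n\gg b_n$ means $a_n/b_n\to\infty$. The Kolmogorov distance of two laws is the supremum distance of their distribution functions. *)

(* Defs.v *)
From HB Require Import structures.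
From mathcomp Require Import all_boot all_order all_algebra.
From mathcomp Require Import all_classical all_reals all_analysis.

Set Implicit Arguments.
Unset Strict Implicit.
Unset Printing Implicit Defensive.

Import Order.TTheory GRing.Theory Num.Theory.
Import numFieldNormedType.Exports.

Local Open Scope classical_set_scope.
Local Open Scope ring_scope.

(* The configuration space {-1, +1}^n with the discrete sigma-algebra; the
   coordinates are coded by booleans and decoded by [spin]. *)
Definition config (n : nat) : Type := {ffun 'I_n -> bool}.

HB.instance Definition _ (n : nat) := Finite.copy (config n) {ffun 'I_n -> bool}.
HB.instance Definition _ (n : nat) :=
  isPointed.Build (config n) [ffun=> true].
HB.instance Definition _ (n : nat) :=
  @isMeasurable.Build default_measure_display (config n)
    discrete_measurable discrete_measurable0
    discrete_measurableC discrete_measurableU.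

Section curie_weiss.
Context {R : realType}.

Definition spin n (x : config n) (i : 'I_n) : R := if x i then 1 else -1.

Definition spin_sum n (x : config n) : R := \sum_(i < n) spin x i.

Definition rho : {measure set R -> \bar R} :=
  measure_add (mscale (2^-1)%:nng \d_(-1 : R)) (mscale (2^-1)%:nng \d_(1 : R)).

(* Since rho is carried by {-1, +1}, the density formula for the law of the
   spins amounts to giving the mass of each point of {-1, +1}^n. *)
Definition cw_weight (beta : R) n (x : config n) : R :=
  expR (beta / (2 * n%:R) * (spin_sum x) ^+ 2)
  * \prod_(i < n) fine (rho [set spin x i]).

Definition cw_Z (beta : R) n : R := \sum_(x : config n) cw_weight beta x.

Definition cw_prob (beta : R) n (A : set (config n)) : \bar R :=
  \sum_(x : config n) (cw_weight beta x / cw_Z beta n)%:E * \d_x A.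

Lemma rho_spin n (x : config n) (i : 'I_n) :
  fine (rho [set spin x i]) = 2^-1.
Proof.
rewrite [rho _]measure_addE /mscale/= /dirac/= !indicE.
have h : (1 == -1 :> R) = false.
  by apply/negbTE; rewrite eq_sym -subr_eq0 -opprD -mulr2n oppr_eq0 pnatr_eq0.
rewrite /spin; case: (x i); rewrite !classical_sets.in_set1 !eqxx ?h 1?eq_sym ?h.
  by rewrite mulr0 add0r mulr1.
by rewrite mulr0 addr0 mulr1.
Qed.

Lemma cw_weight_gt0 (beta : R) n (x : config n) : 0 < cw_weight beta x.
Proof.
rewrite /cw_weight mulr_gt0 ?expR_gt0//; apply: prodr_gt0 => i _.
by rewrite rho_spin invr_gt0.
Qed.

Lemma cw_Z_gt0 (beta : R) n : 0 < cw_Z beta n.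
Proof.
rewrite /cw_Z (bigD1 (point : config n))//= ltr_pwDl ?cw_weight_gt0//.
by apply: sumr_ge0 => x _; exact/ltW/cw_weight_gt0.
Qed.

Section instances.
Variables (beta : R) (n : nat).
Local Open Scope ereal_scope.

Let mass_ge0 (x : config n) : 0 <= (cw_weight beta x / cw_Z beta n)%:E.
Proof. by rewrite lee_fin divr_ge0 ?ltW ?cw_weight_gt0 ?cw_Z_gt0. Qed.

Let cw_prob0 : cw_prob beta (set0 : set (config n)) = 0.
Proof. by rewrite /cw_prob big1// => x _; rewrite measure0 mule0. Qed.

Let cw_prob_ge0 (A : set (config n)) : 0 <= cw_prob beta A.
Proof. by apply: sume_ge0 => x _; exact: mule_ge0. Qed.

Let cw_prob_sigma_additive : semi_sigma_additive (@cw_prob beta n).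
Proof.
move=> F mF tF mUF; rewrite [X in _ --> X](_ : _ =
    lim ((fun m => \sum_(0 <= i < m) cw_prob beta (F i)) @ \oo)).
  by apply: is_cvg_ereal_nneg_natsum => k _; exact: cw_prob_ge0.
rewrite /cw_prob nneseries_sum; last by move=> *; exact: mule_ge0.
apply: eq_bigr => /= x _.
rewrite nneseriesZl//.
by congr (_ * _); exact: measure_semi_bigcup.
Qed.

HB.instance Definition _ := isMeasure.Build _ _ _ (@cw_prob beta n)
  cw_prob0 cw_prob_ge0 cw_prob_sigma_additive.

Let cw_probT : cw_prob beta [set: config n] = 1.
Proof.
rewrite /cw_prob (eq_bigr (fun x => (cw_weight beta x / cw_Z beta n)%:E)).
  by rewrite sumEFin -mulr_suml divff// gt_eqF// cw_Z_gt0.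
by move=> x _; rewrite diracT mule1.
Qed.

HB.instance Definition _ :=
  Measure_isProbability.Build _ _ _ (@cw_prob beta n) cw_probT.

End instances.

Definition curie_weiss (beta : R) n : probability (config n) R :=
  @cw_prob beta n.

Lemma config_measurable n (f : config n -> R) : measurable_fun setT f.
Proof. by []. Qed.

Definition config_rv n (f : config n -> R) : {mfun config n >-> R} :=
  mfun_Sub (mem_set (config_measurable f)).

(* z |-> P_{n,beta} (f <= z), as made explicit in cw_cdfE. *)
Definition cw_cdf (beta : R) n (f : config n -> R) : R -> \bar R :=
  cdf (config_rv f : {RV curie_weiss beta n >-> R}).

Lemma cw_cdfE (beta : R) n (f : config n -> R) z :
  cw_cdf beta f z = curie_weiss beta n [set x | f x <= z].
Proof.
rewrite /cw_cdf /cdf /distribution /pushforward.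
by congr (curie_weiss _ _ _); apply/seteqP; split => x /=; rewrite in_itv.
Qed.

End curie_weiss.

Section distribution_functions.
Context {R : realType}.

(* Arguments are distribution functions; the supremum is taken in the extended
   reals so that no boundedness side condition is hidden in it. *)
Definition kolmogorov_dist (F G : R -> \bar R) : \bar R :=
  ereal_sup (range (fun z => `|F z - G z|%E)).

(* Convergence in distribution, in terms of the distribution functions F_ n of
   the approximating laws and F of the limit law. *)
Definition cvg_in_distribution (F_ : nat -> R -> \bar R) (F : R -> R) : Prop :=
  forall z, {for z, continuous F} -> F_ n z @[n --> \oo] --> (F z)%:E.

Definition F_quartic (gamma z : R) : R :=
  let f x := expR (- (x ^+ 4 / 12) + gamma * x ^+ 2 / 2) in
  (\int[lebesgue_measure]_(x in `]-oo, z]) f x) / \int[lebesgue_measure]_x f x.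

Definition F_critical (z : R) : R :=
  let f x := expR (- (x ^+ 4 / 12)) in
  (\int[lebesgue_measure]_(x in `]-oo, z]) f x) / \int[lebesgue_measure]_x f x.

Definition Phi (z : R) : \bar R := normal_prob 0 1 `]-oo, z].

Definition seq_ll (a b : nat -> R) : Prop := a n / b n @[n --> \oo] --> 0.

Definition seq_gg (a b : nat -> R) : Prop := a n / b n @[n --> \oo] --> +oo.

End distribution_functions.

(* Main.v *)
Require Import Defs.
From mathcomp Require Import all_boot all_order all_algebra.
From mathcomp Require Import all_classical all_reals all_analysis.
From mathcomp Require Import measurable_realfun ring lra zify.

Set Implicit Arguments.
Unset Strict Implicit.
Unset Printing Implicit Defensive.

Import Order.TTheory GRing.Theory Num.Theory.
Import numFieldNormedType.Exports.

Local Open Scope classical_set_scope.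
Local Open Scope ring_scope.

(** The sum S of the spins takes the values s = 2 k - n, with probability
    proportional to 'C(n, k) exp (beta s^2 / (2 n)).  The whole proof is a local
    limit theorem for these weights, with an explicit error, followed by a
    comparison of a Riemann sum with an integral.

    Local limit theorem.  The quotient of two consecutive binomial coefficients is
    (N - t) / (N + t), where N = n + 1 and t is the midpoint of the corresponding
    values of s.  By the Taylor expansion of ln ((1 - u) / (1 + u)), multiplying
    these quotients from the centre outwards gives
        'C(n, k) = c exp (- s^2 / (2 n) - s^4 / (12 n^3)) (1 + O(s^2/n^2 + s^6/n^5))
    uniformly in k, with c the same for all k ([flat_bin_close]).  Hence at scale
    sigma, with x = s / sigma, the law of S is proportional to
        exp (b' x^2 / 2 - a' x^4),   a' = sigma^4 / (12 n^3),
                                     b' = (beta - 1) sigma^2 / n,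
    up to a relative error x^2 sigma^2 / n^2 + x^6 sigma^6 / n^5 ([cw_massE]).

    Riemann sums.  If a' and b' are close to the coefficients a and b of a limit
    density f that decays like a Gaussian, all errors are bounded by a multiple of
    1 / (1 + x^2), whose sum over the lattice is controlled by the arctangent;
    the mesh of the lattice contributes O(1 / sigma) ([riemann_normalised]).
    This yields
        sup_z |P(S / sigma <= z) - F(z)|
          <= C (sigma^2/n^2 + sigma^6/n^5 + |a' - a| + |b' - b| + 1/sigma)
    ([kolmogorov_cw]).

    Choice of the scale.  For sigma = n^(3/4), all terms are O(n^(-1/2)) but
    |b' - b|, where b' = (beta - 1) sqrt n: it vanishes in the first case and is
    |beta - 1| sqrt n in the second ([kolmogorov_critical]).  For
    sigma = sqrt (n / (1 - beta)) one has b' = -1, and a' = 1 / (12 n (1 - beta)^2)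
    is the leading error: it tends to 0 as soon as (1 - beta) sqrt n tends to
    infinity and is O(n^(-1/2)) if 1 - beta dominates n^(-1/4)
    ([kolmogorov_normal]). *)

(** * Mean value inequalities and the logarithm of the odds *)

Section calculus.
Context {R : realType}.
Implicit Types (f g : R -> R) (x y u : R).

Lemma mean_value f f' x y : x <= y ->
  (forall u, x <= u <= y -> is_derive u 1 f (f' u)) ->
  exists2 c, x <= c <= y & f y - f x = f' c * (y - x).
Proof.
move=> xy df.
have [||c] := @MVT_segment R f f' x y xy.
- by move=> u; rewrite in_itv/= => /andP[/ltW xu /ltW uy]; apply: df; rewrite xu.
- apply: derivable_within_continuous => u; rewrite in_itv/= => uxy.
  by have [] := df _ uxy.
- by rewrite in_itv/= => ? ?; exists c.
Qed.

Lemma le_of_derive f f' x y : x <= y ->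
  (forall u, x <= u <= y -> is_derive u 1 f (f' u)) ->
  (forall u, x <= u <= y -> 0 <= f' u) -> f x <= f y.
Proof.
move=> xy df f'0; have [c cxy e] := mean_value xy df.
by rewrite -subr_ge0 e mulr_ge0 ?f'0 ?subr_ge0.
Qed.

(** Moving the base point by at most one changes the Cauchy density by at most
    a factor 3, so error terms of that shape can be read at either end of a cell
    of the lattice. *)
Lemma shift_sqr x y : `|y - x| <= 1 -> (1 + y ^+ 2)^-1 <= 3 / (1 + x ^+ 2).
Proof.
have p (u : R) : 0 < 1 + u ^+ 2 by rewrite ltr_pwDl ?sqr_ge0.
move=> yx; rewrite ler_pdivlMr// mulrC ler_pdivrMr//.
have : (y - x) ^+ 2 <= 1 by rewrite -[leLHS]real_normK ?num_real// expr_le1.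
have := sqr_ge0 (y - 2 * x); nra.
Qed.

Lemma is_derive_ln_odds u : -1 < u < 1 ->
  is_derive u 1 (fun v => ln (1 + v) - ln (1 - v)) (2 / (1 - u ^+ 2)).
Proof.
move=> /andP[u1 u2].
have d1 : is_derive (1 + u) 1 (@ln R) (1 + u)^-1 by apply: is_derive1_ln; lra.
have d2 : is_derive (1 - u) 1 (@ln R) (1 - u)^-1 by apply: is_derive1_ln; lra.
have e1 : is_derive u 1 (fun v : R => 1 + v) 1.
  by apply: is_derive_eq; ring.
have e2 : is_derive u 1 (fun v : R => 1 - v) (-1).
  by apply: is_derive_eq; ring.
have D1 := @is_derive1_comp R (@ln R) (fun v => 1 + v) u _ _ d1 e1.
have D2 := @is_derive1_comp R (@ln R) (fun v => 1 - v) u _ _ d2 e2.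
apply: is_derive_eq (is_deriveB D1 D2) _.
have u3 : u ^+ 2 != 1 by rewrite sqrf_eq1 negb_or; apply/andP; split; apply/eqP; nra.
field; rewrite !subr_eq0 eq_sym u3 /=.
by apply/andP; split; apply/eqP; nra.
Qed.

Lemma ln_odds u : -1 < u < 1 ->
  (1 - u) / (1 + u) = expR (- (ln (1 + u) - ln (1 - u))).
Proof.
by move=> /andP[u1 u2]; rewrite opprB expRB !lnK// posrE; lra.
Qed.

(** With [odds_ge], the two-sided Taylor estimate
    ln ((1 + u) / (1 - u)) = 2 u + 2 u^3 / 3 + O(u^5).  The upper bound on the odds
    has no remainder since the Taylor coefficients of this logarithm are
    nonnegative; it is therefore valid up to u = 1, which later makes the tails
    of the binomial law harmless. *)
Lemma odds_le u : 0 <= u < 1 ->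
  (1 - u) / (1 + u) <= expR (- (2 * u + 2 / 3 * u ^+ 3)).
Proof.
move=> /andP[u0 u1]; rewrite ln_odds; last by lra.
rewrite ler_expR lerN2 -subr_ge0.
pose f v : R := (ln (1 + v) - ln (1 - v)) - (2 * v + 2 / 3 * v ^+ 3).
have f0 : f 0 = 0 by rewrite /f addr0 subr0 ln1; ring.
suff : f 0 <= f u by rewrite f0.
apply: (@le_of_derive f (fun v => 2 / (1 - v ^+ 2) - (2 + 2 * v ^+ 2)) 0 u u0).
  move=> v /andP[v0 vu]; have D := @is_derive_ln_odds v ltac:(lra).
  have P : is_derive v 1 (fun v : R => 2 * v + 2 / 3 * v ^+ 3) (2 + 2 * v ^+ 2).
    by apply: is_derive_eq; rewrite /GRing.scale/=; field.
  exact: is_deriveB D P.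
move=> v /andP[v0 vu]; have v1 : 0 < 1 - v ^+ 2 by nra.
by rewrite subr_ge0 ler_pdivlMr//; nra.
Qed.

Lemma odds_ge u : 0 <= u <= 1 / 2 ->
  expR (- (2 * u + 2 / 3 * u ^+ 3 + u ^+ 5)) <= (1 - u) / (1 + u).
Proof.
move=> /andP[u0 u1]; rewrite ln_odds; last by lra.
rewrite ler_expR lerN2 -subr_ge0.
pose f v : R := (2 * v + 2 / 3 * v ^+ 3 + v ^+ 5) - (ln (1 + v) - ln (1 - v)).
have f0 : f 0 = 0 by rewrite /f addr0 subr0 ln1; ring.
suff : f 0 <= f u by rewrite f0.
apply: (@le_of_derive f
   (fun v => (2 + 2 * v ^+ 2 + 5 * v ^+ 4) - 2 / (1 - v ^+ 2)) 0 u u0).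
  move=> v /andP[v0 vu]; have D := @is_derive_ln_odds v ltac:(lra).
  have P : is_derive v 1 (fun v : R => 2 * v + 2 / 3 * v ^+ 3 + v ^+ 5)
      (2 + 2 * v ^+ 2 + 5 * v ^+ 4).
    by apply: is_derive_eq; rewrite /GRing.scale/=; field.
  exact: is_deriveB P D.
move=> v /andP[v0 vu]; have v1 : 0 < 1 - v ^+ 2 by nra.
rewrite subr_ge0 ler_pdivrMr//.
have v4 : 0 <= v ^+ 2 * v ^+ 2 by rewrite mulr_ge0 ?sqr_ge0.
have v5 : v ^+ 2 <= 1 / 4 by nra.
have -> : v ^+ 4 = v ^+ 2 * v ^+ 2 by ring.
set w := v ^+ 2 in v4 v5 *; nra.
Qed.

End calculus.

(** * Binomial coefficients near the centre *)

Section central_binomial.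
Context {R : realType}.

Definition excess n k : R := 2 * k%:R - n%:R.

(** A binomial coefficient divided by its Gaussian profile with the quartic
    correction, as a function of the sum of the spins.  The temperature enters
    the law of the sum only through a Gaussian factor, so a single estimate of
    these numbers serves all the regimes. *)
Definition flat_bin n k : R :=
  'C(n, k)%:R * expR (excess n k ^+ 2 / (2 * n%:R)
                      + excess n k ^+ 4 / (12 * n%:R ^+ 3)).

Lemma excess_rev n k : (k <= n)%N -> excess n (n - k) = - excess n k.
Proof. by move=> kn; rewrite /excess natrB//; ring. Qed.

Lemma flat_bin_rev n k : (k <= n)%N -> flat_bin n (n - k) = flat_bin n k.
Proof.
move=> kn; rewrite /flat_bin bin_sub// excess_rev// sqrrN.
by rewrite -[4%N]/(2 * 2)%N exprM sqrrN -exprM.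
Qed.

Lemma flat_bin_gt0 n k : (k <= n)%N -> 0 < flat_bin n k.
Proof. by move=> kn; rewrite mulr_gt0 ?expR_gt0// ltr0n bin_gt0. Qed.

(** Consecutive quotients are explicit, with the midpoint t of two successive
    values of the sum as natural variable: the odds of t / (n + 1) times an
    exponential that cancels their Taylor polynomial. *)
Lemma flat_binS n k : (k < n)%N -> let t := excess n k + 1 in
  flat_bin n k.+1 =
  flat_bin n k * ((1 - t / n.+1%:R) / (1 + t / n.+1%:R)
    * expR (2 * t / n%:R + 2 / 3 * (t ^+ 3 + t) / n%:R ^+ 3)).
Proof.
move=> kn t.
have n0 : n%:R != 0 :> R by rewrite pnatr_eq0; case: n kn {t}.
have k0 : k%:R + 1 != 0 :> R by rewrite natr1 pnatr_eq0.
have N0 : n%:R + 1 != 0 :> R by rewrite natr1 pnatr_eq0.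
have odds : (1 - t / n.+1%:R) / (1 + t / n.+1%:R) = (n - k)%:R / k.+1%:R.
  rewrite natrB ?(ltnW kn)// -(@natr1 R n) -(@natr1 R k) /t /excess.
  field; rewrite N0 k0 /= -[X in X != 0](_ : 2 * (k%:R + 1) = _); last by ring.
  by rewrite mulf_neq0 ?pnatr_eq0.
rewrite odds /flat_bin.
have -> : 'C(n, k.+1)%:R = 'C(n, k)%:R * ((n - k)%:R / k.+1%:R) :> R.
  by rewrite mulrA -natrM mulnC -mul_bin_left natrM [X in X / _]mulrC mulfK ?pnatr_eq0.
rewrite [RHS]mulrACA -expRD; congr (_ * expR _).
rewrite /t /excess -(@natr1 R k); field; exact: n0.
Qed.

(** The linear and cubic terms of the logarithm cancel up to the replacement of
    n + 1 by n and to the extra t in t^3 + t, which together cost at most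
    5 t / n^2 since t <= n. *)
Lemma flat_binS_le n k : (k < n)%N -> let t := excess n k + 1 in 0 <= t ->
  flat_bin n k.+1 <= flat_bin n k * expR (5 * t / n%:R ^+ 2).
Proof.
move=> kn t t0; rewrite flat_binS// -/t ler_pM2l ?flat_bin_gt0 1?ltnW//.
have n0 : 0 < n%:R :> R by rewrite ltr0n; case: n kn {t t0}.
have tn : t <= n%:R.
  have : k%:R + 1 <= n%:R :> R by rewrite natr1 ler_nat.
  by rewrite /t /excess; lra.
have ut : 0 <= t / n.+1%:R < 1.
  by rewrite divr_ge0//= ltr_pdivrMr ?ltr0n// -(@natr1 R n); lra.
apply: le_trans (ler_wpM2r (expR_ge0 _) (odds_le ut)) _.
rewrite -expRD ler_expR -(@natr1 R n) -subr_ge0.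
set m : R := n%:R in n0 tn *.
have m1 : 0 < m + 1 by lra.
have -> : 5 * t / m ^+ 2 - (- (2 * (t / (m + 1)) + 2 / 3 * (t / (m + 1)) ^+ 3) +
    (2 * t / m + 2 / 3 * (t ^+ 3 + t) / m ^+ 3)) =
  t / (m ^+ 3 * (m + 1) ^+ 3) * (m * (m + 1) ^+ 2 * (5 * (m + 1) - 2 * m)
    - 2 / 3 * (t ^+ 2 * (3 * m ^+ 2 + 3 * m + 1)) - 2 / 3 * (m + 1) ^+ 3).
  by field; rewrite !gt_eqF.
rewrite mulr_ge0// ?divr_ge0// ?mulr_ge0// ?exprn_ge0//; try lra.
have t2 : t ^+ 2 <= m ^+ 2 by rewrite ler_pXn2r// nnegrE; lra.
have : t ^+ 2 * (3 * m ^+ 2 + 3 * m + 1) <= m ^+ 2 * (3 * m ^+ 2 + 3 * m + 1).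
  by rewrite ler_wpM2r//; nra.
have m0 : 1 <= m by rewrite /m ler1n; case: n kn {t t0 n0 tn ut m m1 t2}.
by move: m0 {t2 tn ut n0 m1} => m0; nra.
Qed.

(** From below, the same corrections have the good sign, and only the fifth order
    remainder of [odds_ge] is left. *)
Lemma flat_binS_ge n k : (k < n)%N -> let t := excess n k + 1 in
  0 <= t -> 2 * t <= n%:R ->
  flat_bin n k * expR (- (t ^+ 5 / n%:R ^+ 5)) <= flat_bin n k.+1.
Proof.
move=> kn t t0 tn; rewrite flat_binS// -/t ler_pM2l ?flat_bin_gt0 1?ltnW//.
have n0 : 0 < n%:R :> R by rewrite ltr0n; case: n kn {t t0 tn}.
have ut : 0 <= t / n.+1%:R <= 1 / 2.
  by rewrite divr_ge0//= ler_pdivrMr ?ltr0n// -(@natr1 R n); lra.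
apply: le_trans (ler_wpM2r (expR_ge0 _) (odds_ge ut)).
rewrite -expRD ler_expR -(@natr1 R n).
set m : R := n%:R in n0 tn *.
have m1 : 0 < m + 1 by lra.
have le_inv : forall i, (t / (m + 1)) ^+ i <= (t / m) ^+ i.
  move=> i; rewrite lerXn2r// ?nnegrE ?divr_ge0//; try lra.
  by rewrite ler_wpM2l// lef_pV2// ?posrE//; lra.
have := le_inv 1%N; have := le_inv 3%N; have := le_inv 5%N.
rewrite !expr1 -expr_div_n => l5 l3 l1.
have -> : 2 * t / m + 2 / 3 * (t ^+ 3 + t) / m ^+ 3 =
  2 * (t / m) + 2 / 3 * (t / m) ^+ 3 + 2 / 3 * (t / m ^+ 3).
  by field; rewrite gt_eqF.
have : 0 <= t / m ^+ 3 by rewrite divr_ge0// exprn_ge0// ltW.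
lra.
Qed.

Let natS_mul m (x : R) : m.+1%:R * x = m%:R * x + x.
Proof. by rewrite -(@natr1 R m) mulrDl mul1r. Qed.

Lemma excess_half_ge n m : 2 * m%:R - 1 <= excess n (n./2 + m).
Proof.
have := odd_double_half n; rewrite -muln2 => /(congr1 (fun k => k%:R : R)).
rewrite !natrD natrM /excess natrD.
by case: (odd n) => /= e; lra.
Qed.

(** The step estimates are monotone in t, so m steps away from the centre cost at
    most m times the last of them; T is any bound for the final excess. *)
Lemma flat_bin_le_half n m T : 0 <= T ->
  (n./2 + m <= n)%N -> excess n (n./2 + m) <= T ->
  flat_bin n (n./2 + m) <= flat_bin n n./2 * expR (m%:R * (5 * T / n%:R ^+ 2)).
Proof.
move=> T0; elim: m => [|m IH] mn eT.
  by rewrite addn0 mul0r expR0 mulr1.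
rewrite addnS in mn eT *.
have e1 : excess n (n./2 + m).+1 = excess n (n./2 + m) + 2.
  by rewrite /excess -(@natr1 R (n./2 + m)); ring.
have t0 : 0 <= excess n (n./2 + m) + 1.
  by have := excess_half_ge n m; have : 0 <= m%:R :> R by []; lra.
apply: le_trans (flat_binS_le mn t0) _.
rewrite (natS_mul m) expRD mulrA; apply: ler_pM.
- by rewrite ltW// flat_bin_gt0// ltnW.
- exact: expR_ge0.
- by apply: IH; [exact: ltnW|lra].
- by rewrite ler_expR ler_wpM2r ?invr_ge0 ?exprn_ge0//; lra.
Qed.

Lemma flat_bin_ge_half n m T : 0 <= T -> 2 * T <= n%:R ->
  (n./2 + m <= n)%N -> excess n (n./2 + m) <= T ->
  flat_bin n n./2 * expR (- (m%:R * (T ^+ 5 / n%:R ^+ 5))) <= flat_bin n (n./2 + m).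
Proof.
move=> T0 Tn; elim: m => [|m IH] mn eT.
  by rewrite addn0 mul0r oppr0 expR0 mulr1.
rewrite addnS in mn eT *.
have e1 : excess n (n./2 + m).+1 = excess n (n./2 + m) + 2.
  by rewrite /excess -(@natr1 R (n./2 + m)); ring.
have t0 : 0 <= excess n (n./2 + m) + 1.
  by have := excess_half_ge n m; have : 0 <= m%:R :> R by []; lra.
have t1 : 2 * (excess n (n./2 + m) + 1) <= n%:R by lra.
apply: le_trans (flat_binS_ge mn t0 t1).
rewrite (natS_mul m) opprD expRD mulrA; apply: ler_pM.
- by rewrite mulr_ge0 ?expR_ge0// ltW// flat_bin_gt0// -divn2 leq_div.
- exact: expR_ge0.
- by apply: IH; [exact: ltnW|lra].
- rewrite ler_expR lerN2 ler_wpM2r ?invr_ge0 ?exprn_ge0//.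
  by rewrite lerXn2r// ?nnegrE; lra.
Qed.

Lemma expR_close (M r e1 e2 : R) : 0 <= e2 -> 0 <= e1 <= M ->
  - e2 <= r <= e1 -> `|expR r - 1| <= expR M * e1 + e2.
Proof.
move=> e20 /andP[e10 e15] /andP[r2 r1].
have EM := expR_ge0 M.
rewrite ler_norml; apply/andP; split.
  by have := expR_ge1Dx r; have := mulr_ge0 EM e10; lra.
have : expR r - 1 <= expR e1 * e1.
  have : expR r <= expR e1 by rewrite ler_expR.
  have : expR e1 * expR (- e1) = 1 by rewrite expRxMexpNx_1.
  have := expR_ge1Dx (- e1); have := expR_gt0 e1.
  set a := expR e1; set b := expR (- e1) => a0 b1 ab ra.
  by have := ler_wpM2l (ltW a0) b1; rewrite ab; lra.
have : expR e1 * e1 <= expR M * e1 by rewrite ler_wpM2r// ler_expR.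
lra.
Qed.

(** The quantitative local limit theorem: up to a multiplicative constant, the
    binomial coefficient is its corrected Gaussian profile with relative error
    s^2 / n^2 + s^6 / n^5, uniformly in the excess s.  Normalising by the
    central coefficient makes Stirling's formula superfluous, as a law is not
    changed when all its weights are multiplied by a constant. *)
Lemma flat_bin_close n k : (0 < n)%N -> (k <= n)%N ->
  `|flat_bin n k / flat_bin n n./2 - 1| <=
  (5 * expR 5 + 64) * (excess n k ^+ 2 / n%:R ^+ 2 + excess n k ^+ 6 / n%:R ^+ 5).
Proof.
move=> n0; wlog hk : k / (n./2 <= k)%N => [hw kn|kn].
  have [hk|hk] := leqP n./2 k; first exact: hw.
  rewrite -(flat_bin_rev kn); have := hw (n - k)%N.
  rewrite excess_rev// sqrrN -[6%N]/(2 * 3)%N [(- _) ^+ (2 * 3)]exprM sqrrN -exprM.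
  by apply; rewrite ?leq_subr//; have := odd_double_half n; lia.
have m0 : 0 < n%:R :> R by rewrite ltr0n.
have h0 : 0 < flat_bin n n./2 by rewrite flat_bin_gt0// -divn2 leq_div.
set T := `|excess n k|.
have e2E : excess n k ^+ 2 = T ^+ 2 by rewrite /T real_normK ?num_real.
have e6E : excess n k ^+ 6 = T ^+ 6.
  by rewrite -[6%N]/(2 * 3)%N !exprM e2E.
rewrite e2E e6E.
have T0 : 0 <= T by rewrite normr_ge0.
have Tn : T <= n%:R.
  have : k%:R <= n%:R :> R by rewrite ler_nat.
  have : 0 <= k%:R :> R by [].
  by rewrite /T ler_norml /excess; lra.
have [m mk] : {m | k = (n./2 + m)%N} by exists (k - n./2)%N; rewrite subnKC.
have mT : m%:R <= T.
  case: m mk => [//|m] mk.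
  have := excess_half_ge n m.+1; rewrite -mk.
  have := ler_norm (excess n k); rewrite -/T.
  have : 1 <= m.+1%:R :> R by rewrite ler1n.
  lra.
have eT : excess n (n./2 + m) <= T by rewrite -mk ler_norm.
have mn : (n./2 + m <= n)%N by rewrite -mk.
have q0 : 0 < flat_bin n k / flat_bin n n./2 by rewrite divr_gt0 ?h0 ?flat_bin_gt0.
have rE : flat_bin n k / flat_bin n n./2 =
  expR (ln (flat_bin n k / flat_bin n n./2)) by rewrite lnK.
set r := ln _ in rE.
(* The error of the upper bound stays bounded up to the end of the lattice. *)
have u5 : 5 * T / n%:R ^+ 2 * T <= 5.
  rewrite mulrAC ler_pdivrMr ?exprn_gt0// -mulrA ler_wpM2l//.
  by rewrite -expr2 lerXn2r ?nnegrE// ltW.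
have r1 : r <= 5 * T / n%:R ^+ 2 * T.
  have := flat_bin_le_half T0 mn eT; rewrite -mk -ler_pdivrMl// mulrC rE ler_expR.
  move/le_trans; apply; rewrite mulrC ler_wpM2l// divr_ge0 ?exprn_ge0//.
  by rewrite mulr_ge0.
have c0 : 0 <= 5 * T / n%:R ^+ 2 * T by rewrite mulr_ge0// divr_ge0 ?exprn_ge0// mulr_ge0.
have T6 : 0 <= T ^+ 6 / n%:R ^+ 5 by rewrite divr_ge0 ?exprn_ge0.
have e5 := expR_gt0 (5 : R).
have T2 : 0 <= T ^+ 2 / n%:R ^+ 2 by rewrite divr_ge0 ?exprn_ge0.
have EE := mulr_ge0 (ltW e5) T6.
apply: (@le_trans _ _ (expR 5 * (5 * T / n%:R ^+ 2 * T)
    + 64 * (T ^+ 6 / n%:R ^+ 5))); last first.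
  have -> : 5 * T / n%:R ^+ 2 * T = 5 * (T ^+ 2 / n%:R ^+ 2).
    by field; rewrite gt_eqF.
  by lra.
have [T2n|nT2] := leP (2 * T) n%:R.
  rewrite rE; apply: expR_close; rewrite ?c0 ?r1 ?mulr_ge0// andbT.
  have := flat_bin_ge_half T0 T2n mn eT.
  rewrite -mk -ler_pdivlMl// [X in _ <= X]mulrC rE ler_expR.
  apply: le_trans; rewrite lerN2.
  apply: (@le_trans _ _ (T ^+ 6 / n%:R ^+ 5)); last by lra.
  rewrite [T ^+ 6]exprS -mulrA ler_wpM2r//.
  by rewrite divr_ge0 ?exprn_ge0.
(* Far from the centre only the trivial lower bound 0 is available, but there
   the claimed error is at least 1. *)
have big : 1 <= 64 * (T ^+ 6 / n%:R ^+ 5).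
  rewrite mulrA ler_pdivlMr ?exprn_gt0// mul1r.
  have : n%:R ^+ 6 <= (2 * T) ^+ 6 by rewrite lerXn2r ?nnegrE//; lra.
  have -> : (2 * T) ^+ 6 = 64 * T ^+ 6 by ring.
  by apply: le_trans; rewrite [leRHS]exprS ler_peMl ?exprn_ge0// ler1n.
have [r2|r2] := leP (- (64 * (T ^+ 6 / n%:R ^+ 5))) r.
  by rewrite rE; apply: expR_close; rewrite ?c0 ?r1 ?r2 ?mulr_ge0.
have er : expR r <= 1 by rewrite -expR0 ler_expR; lra.
have := expR_ge0 r; have := mulr_ge0 (ltW e5) c0.
by rewrite rE ler_norml => ? ?; apply/andP; split; lra.
Qed.

End central_binomial.

(** * Riemann sums of a density on the lattice of spin sums *)

(** The weights w are close to the density f at the points of a lattice of mesh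
    h = 2 / sigma.  The conclusions compare sums of weights with the primitive F of
    f.  All errors are controlled by the density 1 / (1 + x^2), whose primitive atan
    is explicit and bounded. *)
Section riemann_sum.
Context {R : realType}.
Variables (f F : R -> R) (Z D : R).
Hypothesis dF : forall x : R, is_derive x 1 F (f x).
Hypothesis F_ge0 : forall x, 0 <= F x.
Hypothesis F_le : forall x, F x <= Z.
Hypothesis f_bound : forall x, `|f x| <= D.
Hypothesis f_lip : forall x y, `|y - x| <= 1 ->
  `|f y - f x| <= D * `|y - x| / (1 + x ^+ 2).

Let D_ge0 : 0 <= D.
Proof. exact: le_trans (normr_ge0 (f 0)) (f_bound 0). Qed.

(** Makes the sums of the Cauchy errors over the lattice telescope. *)
Lemma atan_step (x h : R) : 0 <= h <= 1 ->
  h / (1 + x ^+ 2) <= 3 * (atan (x + h) - atan x).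
Proof.
move=> /andP[h0 h1].
have xxh : x <= x + h by rewrite lerDl.
have [c /andP[c1 c2] ->] := @mean_value R (@atan R)
    (fun u => (1 + u ^+ 2)^-1) x (x + h) xxh (fun u _ => is_derive1_atan u).
rewrite addrAC subrr add0r mulrA [leLHS]mulrC ler_wpM2r//.
have xc : `|x - c| <= 1 by rewrite ler_norml; lra.
have := shift_sqr xc; lra.
Qed.

Variables (n : nat) (sigma delta : R) (w : nat -> R).
Hypothesis sigma_ge2 : 2 <= sigma.
Hypothesis delta_ge0 : 0 <= delta.
Let x k := excess n k / sigma.
Let h := 2 / sigma.
Hypothesis w_close : forall k, (k <= n)%N ->
  `|w k - f (x k)| <= D * delta / (1 + x k ^+ 2).
Hypothesis F_left : forall u, u <= - (n%:R / sigma) -> F u <= D * delta.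
Hypothesis F_right : forall u, n%:R / sigma <= u -> Z - F u <= D * delta.

Let sigma_gt0 : 0 < sigma. Proof. exact: lt_le_trans sigma_ge2. Qed.
Let h01 : 0 <= h <= 1.
Proof.
apply/andP; split; first by rewrite divr_ge0// ltW.
by rewrite ler_pdivrMr// mul1r.
Qed.

Let h_ge0 : 0 <= h. Proof. by case/andP: h01. Qed.
Let h_le1 : h <= 1. Proof. by case/andP: h01. Qed.

Let xS k : x k.+1 = x k + h.
Proof. by rewrite /x /h /excess -(@natr1 R k); field; rewrite gt_eqF. Qed.

Let x0 : x 0 = - (n%:R / sigma).
Proof. by rewrite /x /excess mulr0 sub0r mulNr. Qed.

Let xn : x n = n%:R / sigma.
Proof. by rewrite /x /excess; congr (_ / _); ring. Qed.

Let le_x j k : (j <= k)%N -> x j <= x k.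
Proof. by move=> jk; rewrite /x ler_pM2r ?invr_gt0// /excess lerB// ler_pM2l// ler_nat. Qed.

Let F_step (u v : R) : u <= v <= u + h -> `|F v - F u| <= D * h.
Proof.
move=> /andP[uv vh]; have [c _ ->] := @mean_value R F f u v uv (fun u _ => dF u).
rewrite normrM ler_pM// ger0_norm; lra.
Qed.

(** In each cell, the mean value theorem writes the increment of F as h times a
    value of f in that cell; the two errors, due to w and to the variation of f,
    are summed by [atan_step]. *)
Lemma riemann_partial j : (j <= n.+1)%N ->
  `|h * \sum_(k < j) w k - (F (x j) - F (x 0))| <=
  3 * D * (delta + h) * (atan (x j) - atan (x 0)).
Proof.
elim: j => [|j IH] jn; first by rewrite big_ord0 mulr0 !subrr normr0 mulr0.
have [c cx eF] :=
  @mean_value R F f (x j) (x j.+1) (le_x (leqnSn j)) (fun u _ => dF u).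
have xj : `|c - x j| <= h by rewrite ger0_norm; move: cx; rewrite xS; lra.
rewrite big_ord_recr /= mulrDr.
rewrite (_ : _ - _ = (h * \sum_(k < j) w k - (F (x j) - F (x 0)))
   + h * ((w j - f (x j)) - (f c - f (x j)))); last first.
  have xe : x j.+1 - x j = h by rewrite xS; ring.
  have -> : F (x j.+1) = F (x j) + f c * h by rewrite -xe -eF; ring.
  ring.
apply: le_trans (ler_normD _ _) _.
have -> : atan (x j.+1) - atan (x 0) =
  (atan (x j) - atan (x 0)) + (atan (x j.+1) - atan (x j)) by ring.
rewrite [leRHS]mulrDr lerD ?IH 1?ltnW//.
rewrite normrM ger0_norm//.
have := atan_step (x j) h01; rewrite -xS => st.
have p : 0 < 1 + x j ^+ 2 by rewrite ltr_pwDl ?sqr_ge0.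
apply: (@le_trans _ _ (h * (D * (delta + h) / (1 + x j ^+ 2)))).
  rewrite ler_wpM2l//.
  apply: le_trans (ler_normB _ _) _.
  rewrite mulrDr mulrDl lerD ?w_close//.
  apply: le_trans (f_lip (le_trans xj h_le1)) _.
  by rewrite ler_pM2r ?invr_gt0// ler_wpM2l.
rewrite mulrCA.
have -> : 3 * D * (delta + h) * (atan (x j.+1) - atan (x j)) =
   D * (delta + h) * (3 * (atan (x j.+1) - atan (x j))) by ring.
by rewrite ler_wpM2l// mulr_ge0// addr_ge0.
Qed.

Let atan_diff (u v : R) : atan u - atan v <= pi.
Proof. by have := atan_ltpi2 u; have := atan_gtNpi2 v; lra. Qed.

Lemma riemann_partial_le j : (j <= n.+1)%N ->
  `|h * \sum_(k < j) w k - F (x j)| <= (3 * pi + 1) * D * (delta + h).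
Proof.
move=> jn; have := riemann_partial jn.
have : 3 * D * (delta + h) * (atan (x j) - atan (x 0)) <= 3 * D * (delta + h) * pi.
  by rewrite ler_wpM2l// mulr_ge0 ?mulr_ge0 ?addr_ge0.
have := F_ge0 (x 0); have := @F_left (x 0); rewrite x0 lexx => /(_ isT).
have := mulr_ge0 D_ge0 h_ge0.
set S := h * _; set A := _ * pi; set B := _ * (_ - _) => Dh Fd F0 AB.
have -> : (3 * pi + 1) * D * (delta + h) = A + D * delta + D * h by rewrite /A; ring.
rewrite !ler_norml => /andP[lo hi]; apply/andP; split; lra.
Qed.

Lemma cut_index (z : R) N :
  exists2 j, (j <= N)%N & forall k, (k < N)%N -> (x k <= z) = (k < j)%N.
Proof.
elim: N => [|N [j jN jP]]; first by exists 0.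
have [xz|zx] := leP (x N) z.
  exists N.+1 => // k kN; rewrite kN; apply: le_trans xz.
  by apply: le_x; rewrite -ltnS.
exists j => [|k]; first exact: leqW.
rewrite ltnS leq_eqVlt => /predU1P[->|]; last exact: jP.
by rewrite leNgt zx ltnNge jN.
Qed.

Lemma riemann_cdf (z : R) :
  `|h * \sum_(k < n.+1 | x k <= z) w k - F z| <= (3 * pi + 3) * D * (delta + h).
Proof.
have [j jn jP] := cut_index z n.+1.
have -> : \sum_(k < n.+1 | x k <= z) w k = \sum_(k < j) w k.
  rewrite (big_ord_widen_cond _ (fun=> true) w jn); apply: eq_bigl => k.
  by rewrite jP.
have := riemann_partial_le jn.
suff : `|F (x j) - F z| <= D * delta + D * h.
  set S := h * _ => a b.
  have := ler_normD (S - F (x j)) (F (x j) - F z).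
  have -> : S - F (x j) + (F (x j) - F z) = S - F z by ring.
  have : 0 <= D * (delta + h) by rewrite mulr_ge0// addr_ge0.
  by lra.
have Dd := mulr_ge0 D_ge0 delta_ge0.
have Dh := mulr_ge0 D_ge0 h_ge0.
have [j0|j0] := posnP j.
  have zx : z <= - (n%:R / sigma).
    by rewrite -x0 ltW// ltNge jP// j0.
  have := F_left zx; have := @F_left (x 0); rewrite j0 x0 lexx => /(_ isT).
  have := F_ge0 z; have := F_ge0 (- (n%:R / sigma)).
  by rewrite ler_norml => *; apply/andP; split; lra.
have zx1 : x j.-1 <= z by rewrite jP ?prednK.
have [jn1|jn1] := ltnP j n.+1.
  have zx2 : z <= x j by rewrite ltW// ltNge jP// ltnn.
  apply: (@le_trans _ _ (D * h)); last by lra.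
  apply: F_step; rewrite zx2/=.
  by have := xS j.-1; rewrite prednK// => ->; rewrite lerD2r.
have jE : j = n.+1 by apply/eqP; rewrite eqn_leq jn jn1.
have zx : n%:R / sigma <= z by rewrite -xn; move: zx1; rewrite jE.
have := F_right zx; have := @F_right (x j); rewrite jE xS xn.
move=> /(_ _)/wrap[]; first by rewrite lerDl.
have := F_le z; have := F_le (n%:R / sigma + h).
by rewrite ler_norml => *; apply/andP; split; lra.
Qed.

Hypothesis w_ge0 : forall k, 0 <= w k.
Hypothesis w_gt0 : 0 < w 0.
Hypothesis Z_gt0 : 0 < Z.

(** Replacing both the partial sum and the total sum by the corresponding
    integrals: A / B - F / Z = ((A - F) - (A / B) (B - Z)) / Z, where A / B is at
    most 1, so that no lower bound on the total weight is needed. *)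
Lemma riemann_normalised (z : R) :
  `|(\sum_(k < n.+1 | x k <= z) w k) / (\sum_(k < n.+1) w k) - F z / Z| <=
  (6 * pi + 5) * D / Z * (delta + h).
Proof.
set A := \sum_(k < n.+1 | _) _; set B := \sum_(k < n.+1) _.
have B_gt0 : 0 < B.
  by rewrite /B big_ord_recl ltr_pwDl// sumr_ge0.
have A_ge0 : 0 <= A by rewrite sumr_ge0.
have AB : A <= B.
  by rewrite /B (bigID (fun k : 'I_n.+1 => x k <= z))/= lerDl sumr_ge0.
have hA := riemann_cdf z; rewrite -/A in hA.
have hB : `|h * B - Z| <= (3 * pi + 2) * D * (delta + h).
  have := riemann_partial_le (leqnn n.+1); rewrite -/B.
  have := @F_right (x n.+1); have := F_le (x n.+1); rewrite xS xn.
  move=> ZF /(_ _)/wrap[]; first by rewrite lerDl.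
  move: (F _) ZF => a aZ Za.
  have := mulr_ge0 D_ge0 h_ge0.
  have -> : (3 * pi + 2) * D * (delta + h) =
    (3 * pi + 1) * D * (delta + h) + D * delta + D * h by ring.
  set E := _ * (delta + h) => Dh.
  by rewrite !ler_norml => /andP[lo hi]; apply/andP; split; lra.
have -> : A / B - F z / Z = ((h * A - F z) - A / B * (h * B - Z)) / Z.
  by field; rewrite !gt_eqF.
rewrite normrM [`|Z^-1|]ger0_norm ?invr_ge0 ?(ltW Z_gt0)//.
rewrite [leRHS]mulrAC ler_pM2r ?invr_gt0//.
apply: le_trans (ler_normB _ _) _.
have : `|A / B * (h * B - Z)| <= `|h * B - Z|.
  rewrite normrM ler_piMl// ger0_norm ?divr_ge0 ?(ltW B_gt0)// ler_pdivrMr// mul1r; exact: AB.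
have -> : (6 * pi + 5) * D * (delta + h) =
  (3 * pi + 3) * D * (delta + h) + (3 * pi + 2) * D * (delta + h) by ring.
by move=> ?; lra.
Qed.

End riemann_sum.

(** * Distribution function of a sub-Gaussian density *)

Section subgaussian_density.
Context {R : realType}.
Variables (f : R -> R) (K : R).
Hypothesis f_cont : continuous f.
Hypothesis f_gt0 : forall x, 0 < f x.
Hypothesis f_le : forall x, f x <= K * expR (- (x ^+ 2 / 2)).

Local Notation mu := (@lebesgue_measure R).
(* A Gaussian density wider than the given bound: the room between the exponents
   x^2 / 8 and x^2 / 2 absorbs the factor x^2 in the tail estimates. *)
Let g : R -> R := normal_pdf 0 2.
Let F z := \int[mu]_(x in `]-oo, z]) f x.
Let Z := \int[mu]_x f x.

Let K_gt0 : 0 < K.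
Proof.
by have := lt_le_trans (f_gt0 0) (f_le 0); rewrite expr0n mul0r oppr0 expR0 mulr1.
Qed.

Let two0 : 2 != 0 :> R. Proof. by rewrite pnatr_eq0. Qed.

Let peak_gt0 : 0 < normal_peak (2 : R). Proof. exact: normal_peak_gt0. Qed.

Let gE x : g x = normal_peak 2 * expR (- (x ^+ 2 / 8)).
Proof.
rewrite /g normal_pdfE// /normal_fun subr0; congr (_ * expR _).
by field.
Qed.

Let c := K / normal_peak (2 : R).
Let c_gt0 : 0 < c. Proof. exact: divr_gt0. Qed.

Let cg x : c * g x = K * expR (- (x ^+ 2 / 8)).
Proof. by rewrite gE /c mulrA divfK// gt_eqF. Qed.

Let f_le_g x : f x <= c * g x.
Proof.
rewrite cg; apply: le_trans (f_le x) _.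
rewrite ler_pM2l// ler_expR lerN2; have := sqr_ge0 x; lra.
Qed.

Let mf D : measurable_fun D f.
Proof. by apply: measurable_funTS; apply: continuous_measurable_fun; exact: f_cont. Qed.

Let ig (D : set R) : measurable D -> mu.-integrable D (EFin \o g).
Proof.
by move=> mD; apply: integrableS (integrable_normal_pdf 0 2) => //; exact: measurableT.
Qed.

Let icg (D : set R) k : measurable D -> mu.-integrable D (EFin \o (fun x => k * g x)).
Proof.
move=> mD; rewrite (_ : _ \o _ = (fun x => k%:E * (g x)%:E)%E)//.
by apply: integrableZl => //; exact: ig.
Qed.

Lemma subgaussian_integrable (D : set R) : measurable D ->
  mu.-integrable D (EFin \o f).
Proof.
move=> mD; apply: le_integrable (icg c mD) => //.
  by apply/measurable_EFinP; exact: mf.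
move=> x _ /=; rewrite lee_fin !ger0_norm ?f_le_g//; last exact/ltW.
exact: le_trans (ltW (f_gt0 x)) (f_le_g x).
Qed.

Let int_le (D : set R) k : measurable D -> 0 <= k ->
  (forall x, D x -> f x <= k * g x) -> \int[mu]_(x in D) f x <= k.
Proof.
move=> mD k0 fk; apply: (@le_trans _ _ (\int[mu]_(x in D) (k * g x))).
  apply: le_Rintegral => //; [exact: subgaussian_integrable|exact: icg].
rewrite RintegralZl//; last exact: ig.
rewrite ler_piMr// -lee_fin fineK; last first.
  by apply: integrable_fin_num => //; exact: ig.
rewrite -(@integral_normal_pdf R 0 2); apply: ge0_subset_integral => //.
- by apply: measurableT_comp => //; exact: measurable_normal_pdf.
- by move=> x _; rewrite lee_fin normal_pdf_ge0.
Qed.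

Lemma subgaussian_derive (x : R) : is_derive x 1 F (f x).
Proof.
have xu : x < x + 1 by rewrite ltrDl.
have iu := @subgaussian_integrable `]-oo, (x + 1)] (measurable_itv _).
have ax : (ereal_of_itv_bound (-oo%O : itv_bound R) < x%:E)%E by exact: ltNyr.
have [d e] := @continuous_FTC1 R f -oo%O x (x + 1) xu iu ax (@f_cont x).
by apply: DeriveDef; [exact: d|rewrite -derive1E; exact: e].
Qed.

Lemma subgaussian_cdf_ge0 z : 0 <= F z.
Proof. by apply: Rintegral_ge0 => x _; exact/ltW. Qed.

Lemma subgaussian_compl z : Z - F z = \int[mu]_(x in `]z, +oo[) f x.
Proof.
rewrite /Z /F -(set_itvNyy R); apply: Rintegral_itvB => //.
exact: subgaussian_integrable.
Qed.

Lemma subgaussian_cdf_le z : F z <= Z.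
Proof.
rewrite -subr_ge0 subgaussian_compl.
by apply: Rintegral_ge0 => x _; exact/ltW.
Qed.

Lemma subgaussian_mass_gt0 : 0 < Z.
Proof.
have [y _ e] := @mean_value R F f 0 1 ler01 (fun u _ => subgaussian_derive u).
apply: lt_le_trans (subgaussian_cdf_le 1).
have -> : F 1 = F 0 + f y by move: e; lra.
by rewrite ltr_wpDl ?subgaussian_cdf_ge0.
Qed.

(* A Markov inequality: x^2 / v^2 >= 1 where `|x| >= v. *)
Let tail v x : 0 < v -> v <= `|x| -> f x <= 8 * c / v ^+ 2 * g x.
Proof.
move=> v0 vx; apply: le_trans (f_le x) _.
have -> : 8 * c / v ^+ 2 * g x = 8 / v ^+ 2 * (c * g x) by ring.
rewrite cg [leRHS]mulrCA ler_pM2l//.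
have -> : - (x ^+ 2 / 2) = - (x ^+ 2 / 8) - 3 * (x ^+ 2 / 8) by lra.
rewrite expRD mulrC ler_pM2r ?expR_gt0//.
have v2 : v ^+ 2 <= x ^+ 2 by rewrite -[leRHS]real_normK ?num_real// lerXn2r ?nnegrE// ltW.
rewrite ler_pdivlMr ?exprn_gt0//.
have := expR_ge1Dx (3 * (x ^+ 2 / 8)).
have := expR_gt0 (- (3 * (x ^+ 2 / 8))).
have := expRxMexpNx_1 (3 * (x ^+ 2 / 8)).
have := sqr_ge0 x; have := sqr_ge0 v.
set a := expR _; set b := expR _; set X := x ^+ 2 in v2 *; set V := v ^+ 2 in v2 *.
move=> V0 X0 ab b0 aX.
have : b * X <= b * (8 * a) by rewrite ler_wpM2l//; lra.
have : b * V <= b * X by rewrite ler_wpM2l//; lra.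
rewrite [b * (8 * a)]mulrC -mulrA ab; lra.
Qed.

Lemma subgaussian_left v u : 0 < v -> u <= - v -> F u <= 8 * c / v ^+ 2.
Proof.
move=> v0 uv; apply: int_le => //.
  by apply: divr_ge0; [apply: mulr_ge0 => //; exact: ltW|apply: exprn_ge0; exact: ltW].
move=> x /=; rewrite in_itv/= => xu; apply: tail => //.
by rewrite ler0_norm; lra.
Qed.

Lemma subgaussian_right v u : 0 < v -> v <= u -> Z - F u <= 8 * c / v ^+ 2.
Proof.
move=> v0 uv; rewrite subgaussian_compl; apply: int_le => //.
  by apply: divr_ge0; [apply: mulr_ge0 => //; exact: ltW|apply: exprn_ge0; exact: ltW].
move=> x /=; rewrite in_itv/= andbT => xu; apply: tail => //.
by rewrite ger0_norm; lra.
Qed.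

End subgaussian_density.

(** * The law of the sum of the spins *)

Section magnetisation.
Context {R : realType}.

Definition plus_spins n (x : config n) : {set 'I_n} := [set i | x i].

Lemma sum_config n (g : nat -> R) :
  \sum_(x : config n) g #|plus_spins x| = \sum_(k < n.+1) 'C(n, k)%:R * g k.
Proof.
rewrite (reindex (fun A : {set 'I_n} => [ffun i => i \in A] : config n)); last first.
  exists (@plus_spins n) => [A _|x _]; first by apply/setP => i; rewrite inE ffunE.
  by apply/ffunP => i; rewrite ffunE inE.
rewrite (eq_bigr (fun A : {set 'I_n} => g #|A|)); last first.
  by move=> A _; congr (g #|pred_of_set _|); apply/setP => i; rewrite inE ffunE.
have An (A : {set 'I_n}) : (#|A| < n.+1)%N.
  by rewrite ltnS -[leqRHS]card_ord max_card.
rewrite (partition_big (fun A : {set 'I_n} => Ordinal (An A)) predT)//=.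
apply: eq_bigr => k _.
rewrite (eq_bigr (fun=> g k)); last by move=> A /eqP <-.
rewrite sumr_const [RHS]mulr_natl; congr (_ *+ _).
have := card_draws 'I_n k; rewrite card_ord => <-; apply: eq_card => A.
by rewrite !inE.
Qed.

Lemma spin_sumE n (x : config n) : spin_sum x = excess n #|plus_spins x| :> R.
Proof.
rewrite /spin_sum (eq_bigr (fun i => 2 * (x i)%:R - 1 : R)); last first.
  by move=> i _; rewrite /spin; case: (x i) => /=; ring.
rewrite sumrB -mulr_sumr sumr_const card_ord /excess; congr (2 * _ - _).
rewrite -natr_sum; congr (_%:R).
rewrite -sum1_card [RHS]big_mkcond/=; apply: eq_bigr => i _; rewrite inE; by case: (x i).
Qed.

Definition cw_mass (beta : R) n k : R :=
  'C(n, k)%:R * expR (beta / (2 * n%:R) * excess n k ^+ 2).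

(** The weight of a configuration depends only on its number of positive spins,
    and the factors 2^-n cancel. *)
Lemma cw_cdf_binomial (beta : R) n (psi : R -> R) (z : R) :
  cw_cdf beta (fun x : config n => psi (spin_sum x)) z =
  ((\sum_(k < n.+1 | psi (excess n k) <= z) cw_mass beta n k)
   / \sum_(k < n.+1) cw_mass beta n k)%:E.
Proof.
have weightE (x : config n) : cw_weight beta x =
    2^-1 ^+ n * expR (beta / (2 * n%:R) * excess n #|plus_spins x| ^+ 2).
  rewrite /cw_weight spin_sumE mulrC (eq_bigr (fun=> 2^-1)); last first.
    by move=> i _; exact: rho_spin.
  by rewrite prodr_const card_ord.
have ZE : cw_Z beta n = 2^-1 ^+ n * \sum_(k < n.+1) cw_mass beta n k.
  rewrite /cw_Z (eq_bigr _ (fun x _ => weightE x)) -mulr_sumr; congr (_ * _).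
  by rewrite (@sum_config n (fun k => expR (beta / (2 * n%:R) * excess n k ^+ 2))).
rewrite cw_cdfE /curie_weiss/= /cw_prob.
pose P k := psi (excess n k) <= z.
rewrite (eq_bigr (fun x : config n =>
  ((if P #|plus_spins x|
    then 2^-1 ^+ n * expR (beta / (2 * n%:R) * excess n #|plus_spins x| ^+ 2)
    else 0) / cw_Z beta n)%:E)); last first.
  move=> x _; rewrite diracE (_ : (x \in _) = P #|plus_spins x|); last first.
    by rewrite /P -spin_sumE; apply/idP/idP; rewrite inE.
  by rewrite weightE; case: (P _); rewrite ?mule1 ?mule0 ?mul0r.
rewrite sumEFin -mulr_suml; congr (_%:E).
rewrite (@sum_config n (fun k => if P k then
   2^-1 ^+ n * expR (beta / (2 * n%:R) * excess n k ^+ 2) else 0)).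
rewrite ZE [in RHS]big_mkcond/=.
rewrite (eq_bigr (fun k : 'I_n.+1 =>
   2^-1 ^+ n * (if P k then cw_mass beta n k else 0))); last first.
  by move=> k _; case: ifP => _; rewrite ?mulr0// /cw_mass mulrCA.
rewrite -mulr_sumr -mulf_div divff ?mul1r// expf_neq0//.
Qed.

End magnetisation.

(** * The limit densities *)

Section quartic_density.
Context {R : realType}.
Implicit Types a b x y K : R.

(** Covers all the limit laws, (a, b) being (1/12, gamma), (1/12, 0) and (0, -1),
    as well as the densities that interpolate the weights of the model for
    finite n. *)
Definition quartic_density a b x := expR (b * x ^+ 2 / 2 - a * x ^+ 4).

Definition subgaussian (f : R -> R) K := forall x, f x <= K * expR (- (x ^+ 2 / 2)).

Lemma quartic_density_gt0 a b x : 0 < quartic_density a b x.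
Proof. exact: expR_gt0. Qed.

Lemma quartic_density_derive a b x :
  is_derive x 1 (quartic_density a b)
    (quartic_density a b x * (b * x - 4 * a * x ^+ 3)).
Proof.
have P : is_derive x 1 (fun y => b * y ^+ 2 / 2 - a * y ^+ 4) (b * x - 4 * a * x ^+ 3).
  by apply: is_derive_eq; rewrite /GRing.scale/=; field.
exact: is_derive1_comp.
Qed.

Lemma quartic_density_continuous a b : continuous (quartic_density a b).
Proof.
move=> x; have [d _] := quartic_density_derive a b x.
exact/differentiable_continuous/derivable1_diffP.
Qed.

(** From u^4 / 4! <= exp u at u = (1 + x^2) / 2. *)
Definition poly_gauss_max : R := 16 * 24 * expR (1 / 2).

Lemma poly_gauss_max_ge0 : 0 <= poly_gauss_max.
Proof. by apply: mulr_ge0; [rewrite -natrM ler0n|exact: expR_ge0]. Qed.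

Lemma poly_gauss_le x : (1 + x ^+ 2) ^+ 4 * expR (- (x ^+ 2 / 2)) <= poly_gauss_max.
Proof.
have x2 := sqr_ge0 x.
have u0 : 0 <= (1 + x ^+ 2) / 2 by lra.
have := expR_ge1Dxn 3 u0; rewrite -[3.+1`!]/24%N.
have -> : (1 + x ^+ 2) / 2 = 1 / 2 + x ^+ 2 / 2 by lra.
rewrite expRD => h.
rewrite expRN ler_pdivrMr ?expR_gt0// /poly_gauss_max.
rewrite -[leRHS](mulrA (16 * 24)).
have -> : (1 + x ^+ 2) ^+ 4 = 16 * 24 * ((1 / 2 + x ^+ 2 / 2) ^+ 4 / 24) by field.
apply: ler_wpM2l; first by rewrite -natrM ler0n.
by apply: le_trans h; rewrite lerDr.
Qed.

(** How polynomial errors of degree 6 become errors of Cauchy type. *)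
Lemma subgaussian_poly f K p x : subgaussian f K -> 0 <= K ->
  0 <= p <= (1 + x ^+ 2) ^+ 3 -> p * f x <= K * poly_gauss_max / (1 + x ^+ 2).
Proof.
move=> fK K0 /andP[p0 p3].
have q : 0 < 1 + x ^+ 2 by rewrite ltr_pwDl ?sqr_ge0.
rewrite ler_pdivlMr//.
have E0 := expR_ge0 (- (x ^+ 2 / 2)).
apply: (@le_trans _ _ ((1 + x ^+ 2) ^+ 3 * (K * expR (- (x ^+ 2 / 2))) * (1 + x ^+ 2))).
  rewrite ler_pM2r//; apply: (@le_trans _ _ (p * (K * expR (- (x ^+ 2 / 2))))).
    by rewrite ler_wpM2l.
  by rewrite ler_wpM2r// mulr_ge0.
have -> : (1 + x ^+ 2) ^+ 3 * (K * expR (- (x ^+ 2 / 2))) * (1 + x ^+ 2) =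
  K * ((1 + x ^+ 2) ^+ 4 * expR (- (x ^+ 2 / 2))) by ring.
by rewrite ler_wpM2l// poly_gauss_le.
Qed.

Lemma quartic_density_lip a b K x y : subgaussian (quartic_density a b) K -> 0 <= K ->
  `|y - x| <= 1 ->
  `|quartic_density a b y - quartic_density a b x| <=
  3 * (`|b| + 4 * `|a|) * K * poly_gauss_max * `|y - x| / (1 + x ^+ 2).
Proof.
move=> fK K0 yx.
have [c cx ->] : exists2 c, `|c - x| <= `|y - x| &
    quartic_density a b y - quartic_density a b x =
    quartic_density a b c * (b * c - 4 * a * c ^+ 3) * (y - x).
  have [xy|/ltW xy] := leP x y.
    have [c /andP[c1 c2] e] := mean_value xy (fun u _ => quartic_density_derive a b u).
    by exists c => //; rewrite !ger0_norm; lra.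
  have [c /andP[c1 c2] e] := mean_value xy (fun u _ => quartic_density_derive a b u).
  exists c; first by rewrite !ler0_norm; lra.
  by move: e; rewrite -[y - x]opprB mulrN => <-; ring.
rewrite normrM [leRHS](_ : _ = (`|b| + 4 * `|a|) * K * poly_gauss_max
  * (3 / (1 + x ^+ 2)) * `|y - x|); last by ring.
rewrite ler_wpM2r//.
have cx1 := shift_sqr (le_trans cx yx).
have M0 := poly_gauss_max_ge0.
have ba : 0 <= `|b| + 4 * `|a| by have := normr_ge0 a; have := normr_ge0 b; lra.
apply: (@le_trans _ _ ((`|b| + 4 * `|a|) * K * poly_gauss_max * (1 + c ^+ 2)^-1)); last first.
  by rewrite ler_wpM2l// mulr_ge0// mulr_ge0.
rewrite normrM (ger0_norm (ltW (quartic_density_gt0 _ _ _))).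
have c2 := sqr_ge0 c.
have p : 0 <= (1 + c ^+ 2) ^+ 2 <= (1 + c ^+ 2) ^+ 3.
  by rewrite exprn_ge0 ?ler_weXn2l//; lra.
have -> : (`|b| + 4 * `|a|) * K * poly_gauss_max * (1 + c ^+ 2)^-1 =
  (`|b| + 4 * `|a|) * (K * poly_gauss_max / (1 + c ^+ 2)) by ring.
apply: le_trans (ler_wpM2l ba (subgaussian_poly fK K0 p)).
rewrite mulrC [leRHS]mulrA ler_pM2r ?quartic_density_gt0//.
apply: le_trans (ler_normB _ _) _.
have nc : `|c| <= (1 + c ^+ 2) ^+ 2.
  have := sqr_ge0 (`|c| - 1); have := real_normK (num_real c); move: (c ^+ 2) c2 => t; nra.
have nc3 : `|c| ^+ 3 <= (1 + c ^+ 2) ^+ 2.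
  have -> : `|c| ^+ 3 = `|c| * c ^+ 2 by rewrite exprS real_normK ?num_real.
  have := sqr_ge0 (`|c| - 1); have := real_normK (num_real c); move: (c ^+ 2) c2 => t; nra.
rewrite (normrM b) [X in _ + X](_ : _ = 4 * `|a| * `|c| ^+ 3); last first.
  by rewrite [LHS]normrM [X in X * _]normrM normrX ger0_norm.
rewrite mulrDl.
have := ler_wpM2l (normr_ge0 a) nc3; have := ler_wpM2l (normr_ge0 b) nc.
by lra.
Qed.

Lemma expR_lip (u v L : R) : expR u <= L -> expR v <= L ->
  `|expR u - expR v| <= L * `|u - v|.
Proof.
wlog uv : u v / v <= u => [hw|].
  have [/hw//|/ltW vu] := leP v u.
  by move=> uL vL; rewrite distrC (distrC u); exact: hw.
move=> uL vL; rewrite !ger0_norm ?subr_ge0 ?ler_expR//.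
have ev : expR u * expR (v - u) = expR v by rewrite -expRD; congr expR; ring.
have := ler_wpM2l (expR_ge0 u) (expR_ge1Dx (v - u)); rewrite ev.
have uv0 : 0 <= u - v by lra.
by have := ler_wpM2r uv0 uL; lra.
Qed.

(** The two sources of error at a lattice point: the relative error rho of the
    local limit theorem, and the distance of the parameters for finite n from
    those of the limit. *)
Lemma weighted_density_close a b a' b' K C1 tau ups rho x :
  subgaussian (quartic_density a b) K -> subgaussian (quartic_density a' b') K ->
  0 <= K -> 0 <= C1 -> 0 <= tau -> 0 <= ups ->
  `|rho - 1| <= C1 * (tau * x ^+ 2 + ups * x ^+ 6) ->
  `|rho * quartic_density a' b' x - quartic_density a b x| <=
  K * poly_gauss_max * (C1 + 1) * (tau + ups + `|a' - a| + `|b' - b|) / (1 + x ^+ 2).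
Proof.
move=> fK gK K0 C0 tau0 ups0 hrho.
set g := quartic_density a' b' x; set f := quartic_density a b x.
set E := K * expR (- (x ^+ 2 / 2)).
have E0 : 0 <= E by rewrite mulr_ge0 ?expR_ge0.
have x2 := sqr_ge0 x.
have da := normr_ge0 (a' - a); have db := normr_ge0 (b' - b).
have -> : rho * g - f = (rho - 1) * g + (g - f) by ring.
set P := C1 * (tau * x ^+ 2 + ups * x ^+ 6) + (`|b' - b| * x ^+ 2 / 2 + `|a' - a| * x ^+ 4).
have x6 : 0 <= x ^+ 6 by rewrite -[6%N]/(2 * 3)%N exprM exprn_ge0.
have x4 : 0 <= x ^+ 4 by rewrite -[4%N]/(2 * 2)%N exprM exprn_ge0.
apply: (@le_trans _ _ (P * E)).
  rewrite /P [leRHS]mulrDl; apply: le_trans (ler_normD _ _) _; rewrite lerD//.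
    rewrite normrM [`|g|]ger0_norm ?(ltW (quartic_density_gt0 _ _ _))//.
    by rewrite ler_pM// ?(ltW (quartic_density_gt0 _ _ _))// gK.
  apply: le_trans (expR_lip (gK x) (fK x)) _.
  rewrite mulrC ler_wpM2r//.
  have -> : b' * x ^+ 2 / 2 - a' * x ^+ 4 - (b * x ^+ 2 / 2 - a * x ^+ 4) =
    (b' - b) * (x ^+ 2 / 2) - (a' - a) * x ^+ 4 by ring.
  apply: le_trans (ler_normB _ _) _.
  rewrite (normrM (b' - b)) (normrM (a' - a)) (ger0_norm x4).
  by rewrite [`|x ^+ 2 / 2|]ger0_norm ?divr_ge0// mulrA.
set delta := tau + ups + _ + _.
have d0 : 0 <= delta by rewrite /delta; lra.
have Pd : P <= (C1 + 1) * delta * (1 + x ^+ 2) ^+ 3.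
  have h2 : x ^+ 2 <= (1 + x ^+ 2) ^+ 3.
    by move: (x ^+ 2) x2 => t t0; nra.
  have h4 : x ^+ 4 <= (1 + x ^+ 2) ^+ 3.
    rewrite -[4%N]/(2 * 2)%N exprM; move: (x ^+ 2) x2 => t t0.
    have : 0 <= t ^+ 3 by rewrite exprn_ge0.
    by nra.
  have h6 : x ^+ 6 <= (1 + x ^+ 2) ^+ 3.
    rewrite -[6%N]/(2 * 3)%N exprM; move: (x ^+ 2) x2 => t t0.
    by rewrite lerXn2r ?nnegrE//; lra.
  rewrite /P /delta; set q := (1 + _) ^+ 3 in h2 h4 h6 *.
  have := ler_wpM2l tau0 h2; have := ler_wpM2l ups0 h6.
  have := ler_wpM2l da h4; have := ler_wpM2l db h2.
  have q0 : 0 <= q by rewrite exprn_ge0//; lra.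
  have := mulr_ge0 (mulr_ge0 C0 da) q0; have := mulr_ge0 (mulr_ge0 C0 db) q0.
  have := mulr_ge0 tau0 q0; have := mulr_ge0 ups0 q0; have := mulr_ge0 db q0.
  move=> ? ? ? ? ? ? ? s6 s2.
  have : C1 * (tau * x ^+ 2 + ups * x ^+ 6) <= C1 * (tau * q + ups * q).
    by rewrite ler_wpM2l// lerD.
  by lra.
apply: le_trans (ler_wpM2r E0 Pd) _.
have q : 0 < 1 + x ^+ 2 by lra.
rewrite ler_pdivlMr//.
have -> : (C1 + 1) * delta * (1 + x ^+ 2) ^+ 3 * E * (1 + x ^+ 2) =
  (C1 + 1) * delta * (K * ((1 + x ^+ 2) ^+ 4 * expR (- (x ^+ 2 / 2)))) by rewrite /E; ring.
have -> : K * poly_gauss_max * (C1 + 1) * delta = (C1 + 1) * delta * (K * poly_gauss_max) by ring.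
by rewrite ler_wpM2l ?mulr_ge0 ?addr_ge0// ler_wpM2l// poly_gauss_le.
Qed.

End quartic_density.

(** * The Kolmogorov distance for an arbitrary scale *)

Section kolmogorov_estimate.
Context {R : realType}.

Definition density_cdf (f : R -> R) z : R :=
  (\int[lebesgue_measure]_(x in `]-oo, z]) f x) / \int[lebesgue_measure]_x f x.

(** At scale sigma, the quartic coefficient comes from the entropy alone, whereas
    in the quadratic one the entropy is compensated by the interaction. *)
Lemma cw_massE (beta sigma : R) n k : (0 < n)%N -> 0 < sigma ->
  cw_mass beta n k = flat_bin n k *
    quartic_density (sigma ^+ 4 / (12 * n%:R ^+ 3)) ((beta - 1) * sigma ^+ 2 / n%:R)
      (excess n k / sigma).
Proof.
move=> n0 s0; rewrite /cw_mass /flat_bin /quartic_density -[RHS]mulrA -expRD.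
congr (_ * expR _).
by field; rewrite pnatr_eq0 -lt0n n0 gt_eqF.
Qed.

Lemma cw_mass_ge0 (beta : R) n k : 0 <= cw_mass beta n k.
Proof. by rewrite mulr_ge0 ?expR_ge0. Qed.

Lemma cw_mass_gt0 (beta : R) n k : (k <= n)%N -> 0 < cw_mass beta n k.
Proof. by move=> kn; rewrite mulr_gt0 ?expR_gt0// ltr0n bin_gt0. Qed.

(** The estimate from which all the assertions follow.  The successive errors come
    from the local limit theorem, from the parameters of the density, and from
    the mesh of the lattice; the constant depends only on the limit density and
    on the common sub-Gaussian bound K. *)
Lemma cw_cdf_close (a b K : R) : subgaussian (quartic_density a b) K ->
  exists C : R, forall n (beta sigma : R), (0 < n)%N -> 0 < sigma ->
  let a' := sigma ^+ 4 / (12 * n%:R ^+ 3) in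
  let b' := (beta - 1) * sigma ^+ 2 / n%:R in
  subgaussian (quartic_density a' b') K -> forall z,
  `|(\sum_(k < n.+1 | (excess n k / sigma <= z)%R) cw_mass beta n k)
      / (\sum_(k < n.+1) cw_mass beta n k) - density_cdf (quartic_density a b) z| <=
  C * (sigma ^+ 2 / n%:R ^+ 2 + sigma ^+ 6 / n%:R ^+ 5
       + `|a' - a| + `|b' - b| + sigma^-1).
Proof.
move=> fK; set f := quartic_density a b in fK *.
have f_cont : continuous f by exact: quartic_density_continuous.
have f_gt0 x : 0 < f x by exact: quartic_density_gt0.
pose F z := \int[lebesgue_measure]_(x in `]-oo, z]) f x.
pose Z := \int[lebesgue_measure]_x f x.
have dF : forall x : R, is_derive x 1 F (f x) := subgaussian_derive f_cont f_gt0 fK.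
have F_ge0 : forall z, 0 <= F z := subgaussian_cdf_ge0 f_gt0.
have F_le : forall z, F z <= Z := subgaussian_cdf_le f_cont f_gt0 fK.
have Z_gt0 : 0 < Z := subgaussian_mass_gt0 f_cont f_gt0 fK.
have F_left := subgaussian_left f_cont f_gt0 fK.
have F_right := subgaussian_right f_cont f_gt0 fK.
have K0 : 0 <= K.
  by have := ltW (lt_le_trans (f_gt0 0) (fK 0)); rewrite expr0n mul0r oppr0 expR0 mulr1.
have M0 := @poly_gauss_max_ge0 R.
pose C1 : R := 5 * expR 5 + 64.
have C10 : 0 <= C1 by have := expR_ge0 (5 : R); rewrite /C1; lra.
pose D1 := 3 * (`|b| + 4 * `|a|) * K * poly_gauss_max.
pose D2 := K * poly_gauss_max * (C1 + 1).
pose D3 := 8 * (K / normal_peak (2 : R)).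
have D10 : 0 <= D1.
  by rewrite /D1; do 2 apply: mulr_ge0 => //; apply: mulr_ge0 => //;
    apply: addr_ge0 => //; apply: mulr_ge0.
have D20 : 0 <= D2 by rewrite /D2 mulr_ge0 ?mulr_ge0// addr_ge0.
have D30 : 0 <= D3 by rewrite /D3 mulr_ge0// divr_ge0// normal_peak_ge0.
pose D := K + D1 + D2 + D3.
exists (Num.max 2 (2 * (6 * pi + 5) * D / Z)) => n beta sigma n0 s0 a' b' gK z.
have nR : 0 < n%:R :> R by rewrite ltr0n.
set tau := sigma ^+ 2 / _; set ups := sigma ^+ 6 / _.
have tau0 : 0 <= tau by rewrite divr_ge0 ?exprn_ge0// ltW.
have ups0 : 0 <= ups by rewrite divr_ge0 ?exprn_ge0// ltW.
have da := normr_ge0 (a' - a); have db := normr_ge0 (b' - b).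
set delta := tau + ups + _ + _.
have delta0 : 0 <= delta by rewrite /delta; lra.
have si : 0 < sigma^-1 by rewrite invr_gt0.
have eps0 : 0 <= delta + sigma^-1 by rewrite addr_ge0// ltW.
(* A mesh larger than 1 makes the claim weaker than the trivial bound by 1. *)
have [s2|s2] := ltP sigma 2.
  apply: (@le_trans _ _ (2 * (delta + sigma^-1))); last first.
    by rewrite ler_wpM2r// le_max lexx.
  apply: (@le_trans _ _ 1); last first.
    have : 1 <= 2 * sigma^-1 by rewrite ler_pdivlMr// mul1r ltW.
    lra.
  set B := \sum_(k < _) _.
  have B0 : 0 < B.
    by rewrite /B big_ord_recl ltr_pwDl ?cw_mass_gt0// sumr_ge0// => k _; rewrite cw_mass_ge0.
  set A := \sum_(k < _ | _) _.
  have A0 : 0 <= A by rewrite sumr_ge0// => k _; rewrite cw_mass_ge0.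
  have AB : A <= B.
    rewrite /B (bigID (fun k : 'I_n.+1 => excess n k / sigma <= z))/= lerDl sumr_ge0//.
    by move=> k _; rewrite cw_mass_ge0.
  have q1 : 0 <= A / B <= 1 by rewrite divr_ge0 ?(ltW B0)//= ler_pdivrMr// mul1r.
  have q2 : 0 <= F z / Z <= 1 by rewrite divr_ge0 ?(ltW Z_gt0)//= ler_pdivrMr// mul1r.
  rewrite /density_cdf -/(F z) -/Z.
  by rewrite ler_norml; move: q1 q2; move: (A / B) (F z / Z) => ? ?; lra.
pose q0 : R := flat_bin n n./2.
have q0_gt0 : 0 < q0 by rewrite flat_bin_gt0// -divn2 leq_div.
pose w k := cw_mass beta n k / q0.
have w_ge0 k : 0 <= w k.
  by apply: divr_ge0; [exact: cw_mass_ge0|exact: ltW].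
have w_gt0 : 0 < w 0%N.
  by apply: divr_gt0; [exact: cw_mass_gt0|exact: q0_gt0].
have wE (P : pred 'I_n.+1) :
    \sum_(k < n.+1 | P k) cw_mass beta n k = q0 * \sum_(k < n.+1 | P k) w k.
  by rewrite mulr_sumr; apply: eq_bigr => k _; rewrite /w mulrC divfK// gt_eqF.
rewrite wE (wE predT) -mulf_div divff ?gt_eqF// mul1r.
have f_bound x : `|f x| <= D.
  rewrite ger0_norm ?(ltW (f_gt0 x))//; apply: le_trans (fK x) _.
  apply: (@le_trans _ _ K); last by rewrite /D; lra.
  rewrite ler_piMr// -[leRHS]expR0 ler_expR oppr_le0; have := sqr_ge0 x; lra.
have f_lip x y : `|y - x| <= 1 -> `|f y - f x| <= D * `|y - x| / (1 + x ^+ 2).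
  move=> yx; apply: le_trans (quartic_density_lip fK K0 yx) _.
  rewrite -/D1 ler_wpM2r ?invr_ge0 ?addr_ge0 ?sqr_ge0// ler_wpM2r//.
  by rewrite /D; lra.
have w_close k : (k <= n)%N -> `|w k - f (excess n k / sigma)| <=
    D * delta / (1 + (excess n k / sigma) ^+ 2).
  move=> kn; rewrite /w (cw_massE _ _ n0 s0) mulrAC.
  apply: (@le_trans _ _ (D2 * delta / (1 + (excess n k / sigma) ^+ 2))); last first.
    rewrite ler_wpM2r ?invr_ge0 ?addr_ge0 ?sqr_ge0// ler_wpM2r//.
    by rewrite /D; lra.
  apply: (weighted_density_close fK gK K0 C10 tau0 ups0).
  apply: le_trans (flat_bin_close n0 kn) _; rewrite -/C1 ler_wpM2l//.
  rewrite le_eqVlt; apply/orP; left; apply/eqP.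
  by rewrite /tau /ups; field; rewrite !gt_eqF.
have v0 : 0 < n%:R / sigma by rewrite divr_gt0.
(* The tails beyond the last lattice point n / sigma fall under the error tau. *)
have D3d : D3 / (n%:R / sigma) ^+ 2 <= D * delta.
  have -> : D3 / (n%:R / sigma) ^+ 2 = D3 * tau by rewrite /tau; field; rewrite !gt_eqF.
  by apply: ler_pM => //; [rewrite /D|rewrite /delta]; lra.
have FL u : u <= - (n%:R / sigma) -> F u <= D * delta.
  by move=> hu; apply: le_trans (F_left _ _ v0 hu) D3d.
have FR u : n%:R / sigma <= u -> Z - F u <= D * delta.
  by move=> hu; apply: le_trans (F_right _ _ v0 hu) D3d.
have := riemann_normalised dF F_ge0 F_le f_bound f_lip s2 delta0 w_close FL FR
  w_ge0 w_gt0 Z_gt0 z.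
move/le_trans; apply.
apply: (@le_trans _ _ (2 * (6 * pi + 5) * D / Z * (delta + sigma^-1))); last first.
  by rewrite ler_wpM2r// le_max lexx orbT.
have -> : 2 * (6 * pi + 5) * D / Z * (delta + sigma^-1) =
  (6 * pi + 5) * D / Z * (2 * (delta + sigma^-1)) by ring.
rewrite ler_wpM2l//; last by lra.
rewrite divr_ge0 ?(ltW Z_gt0)// mulr_ge0//; last by rewrite /D; lra.
by have := pi_ge0 R; lra.
Qed.

End kolmogorov_estimate.

(** * The critical and the Gaussian scales *)

Section kolmogorov_bounds.
Context {R : realType}.

Lemma density_cdf01 (a b K : R) z : subgaussian (quartic_density a b) K ->
  0 <= density_cdf (quartic_density a b) z <= 1.
Proof.
move=> fK; set f := quartic_density a b in fK *.
have f_cont : continuous f by exact: quartic_density_continuous.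
have f_gt0 x : 0 < f x by exact: quartic_density_gt0.
have Z_gt0 := subgaussian_mass_gt0 f_cont f_gt0 fK.
rewrite /density_cdf divr_ge0 ?(ltW Z_gt0) ?subgaussian_cdf_ge0//=.
by rewrite ler_pdivrMr// mul1r; exact: subgaussian_cdf_le fK _.
Qed.

Lemma kolmogorov_dist_ge0 (F G : R -> \bar R) : (0 <= kolmogorov_dist F G)%E.
Proof.
apply: (@le_trans _ _ (`|F 0%R - G 0%R|)%E); first exact: abse_ge0.
by apply: ereal_sup_ubound; exists 0%R.
Qed.

Lemma kolmogorov_dist_le1 (beta : R) n (f : config n -> R) (G : R -> R) :
  (forall z, 0 <= G z <= 1) ->
  (kolmogorov_dist (cw_cdf beta f) (fun z => (G z)%:E) <= 1)%E.
Proof.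
move=> G01; apply: ge_ereal_sup => _ [z _ <-].
have := cdf_ge0 (config_rv f : {RV curie_weiss beta n >-> R}) z.
have := cdf_le1 (config_rv f : {RV curie_weiss beta n >-> R}) z.
rewrite -/(cw_cdf beta f z).
case: (cw_cdf beta f z) => [r| |]//; rewrite !lee_fin => r1 r0.
by rewrite /= ?lee_fin ler_norml; have /andP[] := G01 z; lra.
Qed.

Lemma kolmogorov_cw (a b K : R) : subgaussian (quartic_density a b) K ->
  exists2 C : R, 0 <= C & forall n (beta sigma : R), (0 < n)%N -> 0 < sigma ->
  let a' := sigma ^+ 4 / (12 * n%:R ^+ 3) in
  let b' := (beta - 1) * sigma ^+ 2 / n%:R in
  subgaussian (quartic_density a' b') K ->
  (kolmogorov_dist (cw_cdf beta (fun x : config n => spin_sum x / sigma)%R)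
     (fun z => (density_cdf (quartic_density a b) z)%:E)
   <= (C * (sigma ^+ 2 / n%:R ^+ 2 + sigma ^+ 6 / n%:R ^+ 5
       + `|a' - a| + `|b' - b| + sigma^-1))%:E)%E.
Proof.
move=> fK; have [C hC] := cw_cdf_close fK.
exists (Num.max 0 C); first by rewrite le_max lexx.
move=> n beta sigma n0 s0 a' b' gK; apply: ge_ereal_sup => _ [z _ <-].
rewrite (@cw_cdf_binomial R beta n (fun s => s / sigma) z) -EFinB /= lee_fin.
apply: le_trans (hC n beta sigma n0 s0 gK z) _.
rewrite ler_wpM2r ?le_max ?lexx ?orbT//.
by rewrite !addr_ge0// ?invr_ge0 ?divr_ge0 ?exprn_ge0// ltW.
Qed.

Lemma natr_sqrt_sqr n : Num.sqrt n%:R ^+ 2 = n%:R :> R.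
Proof. by rewrite sqr_sqrtr. Qed.

Lemma powR_half_sqrt n : n%:R `^ (- (1 / 2)) = (Num.sqrt n%:R)^-1 :> R.
Proof. by rewrite powRN div1r powR12_sqrt. Qed.

Lemma powR_34_sqr n : (n%:R `^ (3 / 4)) ^+ 2 = Num.sqrt n%:R ^+ 3 :> R.
Proof.
rewrite -powR_mulrn ?powR_ge0// -powRrM -powR12_sqrt//.
rewrite -[RHS]powR_mulrn ?powR_ge0// -powRrM; congr (_ `^ _).
by lra.
Qed.

(** With t = x^2 and `|b| <= B, the exponent (B + 1) t / 2 - t^2 / 12 is at most its
    value at t = 3 (B + 1). *)
Lemma subgaussian_critical (B b : R) : 0 <= B -> `|b| <= B ->
  subgaussian (quartic_density (1 / 12) b) (expR (3 * (B + 1) ^+ 2 / 4)).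
Proof.
move=> B0 bB x; rewrite /quartic_density -expRD ler_expR.
have -> : x ^+ 4 = x ^+ 2 * x ^+ 2 by ring.
have bx : b * x ^+ 2 <= B * x ^+ 2.
  by rewrite ler_wpM2r ?sqr_ge0//; move: bB; rewrite ler_norml; lra.
move: (x ^+ 2) bx => t bt; have := sqr_ge0 (t - 3 * (B + 1)); nra.
Qed.

(** At scale n^(3/4) the quartic coefficient is exactly 1/12, the quadratic one is
    (beta - 1) sqrt n, and both errors of the local limit theorem are n^(-1/2). *)
Lemma kolmogorov_critical (B b : R) : 0 <= B -> `|b| <= B ->
  exists2 C : R, 0 <= C & forall n (beta : R), (0 < n)%N ->
  `|(beta - 1) * Num.sqrt n%:R| <= B ->
  (kolmogorov_dist
     (cw_cdf beta (fun x : config n => spin_sum x / n%:R `^ (3 / 4))%R)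
     (fun z => (density_cdf (quartic_density (1 / 12) b) z)%:E)
   <= (C * (`|(beta - 1) * Num.sqrt n%:R - b| + (Num.sqrt n%:R)^-1))%:E)%E.
Proof.
move=> B0 bB; have [C C0 hC] := kolmogorov_cw (subgaussian_critical B0 bB).
exists (3 * C) => [|n beta n0 hB]; first exact: mulr_ge0.
have nR : 0 < n%:R :> R by rewrite ltr0n.
have s0 : 0 < n%:R `^ (3 / 4) :> R by rewrite powR_gt0.
set sigma := n%:R `^ (3 / 4) in s0 *.
set r := Num.sqrt n%:R in hB *.
have r0 : 0 < r by rewrite /r sqrtr_gt0.
have r1 : 1 <= r by have := @ler_wsqrtr R 1 n%:R; rewrite sqrtr1 ler1n; exact.
have nE : n%:R = r ^+ 2 by rewrite natr_sqrt_sqr.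
have s2 : sigma ^+ 2 = r ^+ 3 := powR_34_sqr n.
have s4 : sigma ^+ 4 = r ^+ 6 by rewrite -[4%N]/(2 * 2)%N exprM s2 -exprM.
have s6 : sigma ^+ 6 = r ^+ 9 by rewrite -[6%N]/(2 * 3)%N exprM s2 -exprM.
have := hC n beta sigma n0 s0; rewrite s2 s4 s6 nE.
have -> : r ^+ 6 / (12 * (r ^+ 2) ^+ 3) = 1 / 12 by field; rewrite gt_eqF.
have -> : (beta - 1) * r ^+ 3 / r ^+ 2 = (beta - 1) * r by field; rewrite gt_eqF.
move=> /(_ (subgaussian_critical B0 hB)) /le_trans; apply.
rewrite lee_fin subrr normr0 addr0.
have -> : r ^+ 3 / (r ^+ 2) ^+ 2 = r^-1 by field; rewrite gt_eqF.
have -> : r ^+ 9 / (r ^+ 2) ^+ 5 = r^-1 by field; rewrite gt_eqF.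
have sr : sigma^-1 <= r^-1.
  rewrite lef_pV2 ?posrE// -(@ler_pXn2r _ 2)// ?nnegrE ?(ltW s0) ?(ltW r0)//.
  by rewrite s2 [leRHS]exprS ler_peMl// exprn_ge0// ltW.
rewrite -mulrA mulrCA ler_wpM2l//.
have := normr_ge0 ((beta - 1) * r - b); lra.
Qed.

Lemma subgaussian_normal (a : R) : 0 <= a -> subgaussian (quartic_density a (-1)) 1.
Proof.
move=> a0 x; rewrite /quartic_density mul1r ler_expR.
have : 0 <= a * x ^+ 4 by rewrite mulr_ge0// -[4%N]/(2 * 2)%N exprM sqr_ge0.
lra.
Qed.

Lemma PhiE z : Phi z = (density_cdf (quartic_density 0 (-1 : R)) z)%:E.
Proof.
have sg := @subgaussian_normal 0 (lexx _).
set f := quartic_density 0 (-1 : R) in sg *.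
have f_cont : continuous f by exact: quartic_density_continuous.
have f_gt0 x : 0 < f x by exact: quartic_density_gt0.
pose c := normal_peak (1 : R).
have pdfE : normal_pdf 0 (1 : R) = (fun x => c * f x).
  apply/funext => x; rewrite normal_pdfE ?oner_eq0// /normal_fun subr0.
  by congr (_ * expR _); rewrite expr1n; field.
have i D : measurable D -> (\int[lebesgue_measure]_(x in D) (normal_pdf 0 (1 : R) x)%:E
    = (c * \int[lebesgue_measure]_(x in D) f x)%:E)%E.
  move=> mD; have fi := subgaussian_integrable f_cont f_gt0 sg mD.
  rewrite -RintegralZl// fineK ?pdfE//; apply: integrable_fin_num => //.
  have := integrable_normal_pdf 0 (1 : R); rewrite pdfE.
  by apply: integrableS => //; exact: measurableT.
have cZ : c * \int[lebesgue_measure]_x f x = 1.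
  by apply/EFin_inj; rewrite -i//; exact: integral_normal_pdf.
have Z0 := subgaussian_mass_gt0 f_cont f_gt0 sg.
rewrite /Phi /normal_prob i// /density_cdf; congr (_%:E).
by apply/(mulIf (lt0r_neq0 Z0)); rewrite divfK ?gt_eqF// mulrAC cZ mul1r.
Qed.

(** At scale sqrt (n / (1 - beta)) the quadratic coefficient is exactly -1 and, with
    m = (1 - beta) sqrt n, the quartic one is 1 / (12 m^2), which is the only
    error that may exceed n^(-1/2). *)
Lemma kolmogorov_normal :
  exists2 C : R, 0 <= C & forall n (beta : R), (0 < n)%N -> 0 < beta < 1 ->
  1 <= (1 - beta) * Num.sqrt n%:R ->
  (kolmogorov_dist
     (cw_cdf beta (fun x : config n => spin_sum x / Num.sqrt (n%:R / (1 - beta)))%R)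
     Phi
   <= (C * ((Num.sqrt n%:R)^-1 + ((1 - beta) * Num.sqrt n%:R) ^- 2))%:E)%E.
Proof.
have [C C0 hC] := kolmogorov_cw (@subgaussian_normal 0 (lexx _)).
exists (3 * C) => [|n beta n0 /andP[b0 b1] m1]; first exact: mulr_ge0.
rewrite (_ : Phi = fun z => (density_cdf (quartic_density 0 (-1 : R)) z)%:E); last first.
  by apply/funext => z; exact: PhiE.
have nR : 0 < n%:R :> R by rewrite ltr0n.
set eta := 1 - beta in m1 *.
have e0 : 0 < eta by rewrite /eta; lra.
have e1 : eta <= 1 by rewrite /eta; lra.
have s0 : 0 < Num.sqrt (n%:R / eta) by rewrite sqrtr_gt0 divr_gt0.
set sigma := Num.sqrt _ in s0 *.
set r := Num.sqrt n%:R in m1 *.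
have r0 : 0 < r by rewrite /r sqrtr_gt0.
have r1 : 1 <= r by have := @ler_wsqrtr R 1 n%:R; rewrite sqrtr1 ler1n; exact.
have nE : n%:R = r ^+ 2 by rewrite natr_sqrt_sqr.
have s2 : sigma ^+ 2 = r ^+ 2 / eta.
  by rewrite /sigma sqr_sqrtr -?nE// divr_ge0// ltW.
have s4 : sigma ^+ 4 = (r ^+ 2 / eta) ^+ 2 by rewrite -[4%N]/(2 * 2)%N exprM s2.
have s6 : sigma ^+ 6 = (r ^+ 2 / eta) ^+ 3 by rewrite -[6%N]/(2 * 3)%N exprM s2.
have := hC n beta sigma n0 s0; rewrite s2 s4 s6 nE.
set m := eta * r in m1 *.
have -> : (r ^+ 2 / eta) ^+ 2 / (12 * (r ^+ 2) ^+ 3) = m ^- 2 / 12.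
  by rewrite /m; field; rewrite !gt_eqF.
have -> : (beta - 1) * (r ^+ 2 / eta) / r ^+ 2 = -1.
  by rewrite /eta; field; rewrite gt_eqF// gt_eqF.
have m0 : 0 < m by lra.
have mm0 : 0 <= m ^- 2 by rewrite invr_ge0 exprn_ge0// ltW.
move=> /(_ (subgaussian_normal (divr_ge0 mm0 (ler0n _ _)))) /le_trans; apply.
rewrite lee_fin subrr normr0 addr0 subr0 ger0_norm ?divr_ge0//.
have ri : 0 < r^-1 by rewrite invr_gt0.
have mi : 0 < m^-1 by rewrite invr_gt0.
have mi1 : m^-1 <= 1 by rewrite invf_le1.
have -> : r ^+ 2 / eta / (r ^+ 2) ^+ 2 = r^-1 * m^-1.
  by rewrite /m; field; rewrite !gt_eqF.
have -> : (r ^+ 2 / eta) ^+ 3 / (r ^+ 2) ^+ 5 = r^-1 * m^-1 ^+ 3.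
  by rewrite /m; field; rewrite !gt_eqF.
have sr : sigma^-1 <= r^-1.
  rewrite lef_pV2 ?posrE// -(@ler_pXn2r _ 2)// ?nnegrE ?(ltW s0) ?(ltW r0)//.
  by rewrite s2 ler_pdivlMr// ler_piMr// exprn_ge0// ltW.
have t1 : r^-1 * m^-1 <= r^-1 by rewrite ler_piMr// ltW.
have t3 : r^-1 * m^-1 ^+ 3 <= r^-1.
  by rewrite ler_piMr ?(ltW ri)// exprn_ile1// ltW.
have -> : 3 * C * (r^-1 + m ^- 2) = C * (3 * (r^-1 + m ^- 2)) by ring.
by rewrite ler_wpM2l//; lra.
Qed.

End kolmogorov_bounds.

(** * From non-asymptotic bounds to the asymptotic statements *)

Section asymptotics.
Context {R : realType}.

Lemma F_quarticE (gamma : R) :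
  F_quartic gamma = density_cdf (quartic_density (1 / 12) gamma).
Proof.
rewrite /density_cdf (_ : quartic_density _ _ =
  fun x => expR (- (x ^+ 4 / 12) + gamma * x ^+ 2 / 2))//.
by apply/funext => x; congr expR; field.
Qed.

Lemma F_criticalE : F_critical = density_cdf (quartic_density (1 / 12) (0 : R)).
Proof.
rewrite /density_cdf (_ : quartic_density _ _ = fun x => expR (- (x ^+ 4 / 12)))//.
by apply/funext => x; congr expR; field.
Qed.

Lemma sqrt_nat_ge1 n : (0 < n)%N -> 1 <= Num.sqrt n%:R :> R.
Proof. by move=> n0; have := @ler_wsqrtr R 1 n%:R; rewrite sqrtr1 ler1n; exact. Qed.

(** A bound valid eventually extends to all positive n, since a Kolmogorov distance
    is at most 1. *)
Lemma near_bound_all (d : nat -> \bar R) (C : R) :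
  (forall n, (0 < n)%N -> (d n <= 1)%E) ->
  (\forall n \near \oo, (d n <= (C * (Num.sqrt n%:R)^-1)%:E)%E) ->
  exists C' : R, forall n, (0 < n)%N -> (d n <= (C' * n%:R `^ (- (1 / 2)))%:E)%E.
Proof.
move=> d1 [N _ dN]; exists (Num.max C (Num.sqrt N%:R)) => n n0.
have r1 := sqrt_nat_ge1 n0.
have r0 : 0 < Num.sqrt n%:R :> R by exact: lt_le_trans r1.
rewrite powR_half_sqrt; have [Nn|nN] := leqP N n.
  apply: le_trans (dN n Nn) _; rewrite lee_fin ler_wpM2r ?invr_ge0 ?(ltW r0)//.
  by rewrite le_max lexx.
apply: le_trans (d1 n n0) _; rewrite lee_fin ler_pdivlMr// mul1r le_max.
by apply/orP; right; rewrite ler_wsqrtr// ler_nat ltnW.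
Qed.

Lemma near_cvg0 (d : nat -> \bar R) (C : R) (e : nat -> R) :
  (forall n, (0 <= d n)%E) -> (\forall n \near \oo, (d n <= (C * e n)%:E)%E) ->
  e n @[n --> \oo] --> (0 : R) -> d n @[n --> \oo] --> 0%E.
Proof.
move=> d0 dC e0; apply: (@squeeze_cvge _ _ _ _ (fun=> 0%E) _ (fun n => (C * e n)%:E)).
- by apply: filterS dC => n dn; rewrite d0 dn.
- exact: cvg_cst.
- by apply: cvg_EFin; [exact: nearW|rewrite -(mulr0 C); apply: cvgMr].
Qed.

Lemma cvg_inv_sqrt : (Num.sqrt n%:R)^-1 @[n --> \oo] --> (0 : R).
Proof.
apply/gtr0_cvgV0; first by near=> n; rewrite sqrtr_gt0 ltr0n; near: n; exact: nbhs_infty_gt.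
apply/cvgryPge => A; near=> n.
have A2 : A ^+ 2 <= n%:R by near: n; exact: nbhs_infty_ger.
by apply: le_trans (ler_norm A) _; rewrite -sqrtr_sqr ler_wsqrtr.
Unshelve. all: by end_near. Qed.

Lemma cvg_of_kolmogorov (F_ : nat -> R -> \bar R) (G : R -> R) (e : nat -> R) z :
  (\forall n \near \oo, (kolmogorov_dist (F_ n) (fun z => (G z)%:E) <= (e n)%:E)%E) ->
  e n @[n --> \oo] --> (0 : R) -> F_ n z @[n --> \oo] --> (G z)%:E.
Proof.
move=> dF e0; apply: (@squeeze_cvge _ _ _ _ (fun n => (G z - e n)%:E) _
    (fun n => (G z + e n)%:E)).
- apply: filterS dF => n dn.
  have : (`|F_ n z - (G z)%:E| <= (e n)%:E)%E.
    by apply: le_trans dn; apply: ereal_sup_ubound; exists z.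
  by case: (F_ n z) => [r| |]//=; rewrite !lee_fin ler_norml; lra.
- apply: cvg_EFin; first exact: nearW.
  by rewrite -[X in _ --> X]subr0; apply: cvgB => //; exact: cvg_cst.
- apply: cvg_EFin; first exact: nearW.
  by rewrite -[X in _ --> X]addr0; apply: cvgD => //; exact: cvg_cst.
Qed.

Lemma div_powR_half (x : R) n : x / n%:R `^ (- (1 / 2)) = x * Num.sqrt n%:R.
Proof. by rewrite powR_half_sqrt invrK. Qed.

End asymptotics.

Theorem theorem1p4 (R : realType) (beta : nat -> R)
  (beta_gt0 : forall n, (0 < n)%N -> 0 < beta n)
  (beta_monotone :
    (forall m n, (0 < m)%N -> (m <= n)%N -> beta m <= beta n) \/
    (forall m n, (0 < m)%N -> (m <= n)%N -> beta n <= beta m))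
  (beta_cvg1 : beta n @[n --> \oo] --> (1 : R)) :
  [/\ (* (1) *)
      forall gamma : R, gamma != 0 ->
        (\forall n \near \oo, beta n - 1 = gamma / Num.sqrt n%:R) ->
        exists C : R, forall n, (0 < n)%N ->
          (kolmogorov_dist
             (cw_cdf (beta n) (fun x : config n => spin_sum x / n%:R `^ (3 / 4))%R)
             (fun z => (F_quartic gamma z)%:E)
           <= (C * n%:R `^ (- (1 / 2)))%:E)%E,
      (* (2) *)
      (seq_ll (fun n => `|beta n - 1|) (fun n => n%:R `^ (- (1 / 2))) ->
        cvg_in_distribution
          (fun n =>
             cw_cdf (beta n) (fun x : config n => spin_sum x / n%:R `^ (3 / 4))%R)
          F_critical) /\
      ((fun n => `|beta n - 1| : R) =O_\oo (fun n => n%:R^-1 : R) ->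
        exists C : R, forall n, (0 < n)%N ->
          (kolmogorov_dist
             (cw_cdf (beta n) (fun x : config n => spin_sum x / n%:R `^ (3 / 4))%R)
             (fun z => (F_critical z)%:E)
           <= (C * n%:R `^ (- (1 / 2)))%:E)%E)
    & (* (3) *)
      (forall n, (0 < n)%N -> beta n < 1) ->
      (seq_gg (fun n => `|beta n - 1|) (fun n => n%:R `^ (- (1 / 2))) ->
        kolmogorov_dist
          (cw_cdf (beta n)
             (fun x : config n => Num.sqrt ((1 - beta n) / n%:R) * spin_sum x))
          Phi @[n --> \oo] --> 0%E) /\
      (seq_gg (fun n => `|beta n - 1|) (fun n => n%:R `^ (- (1 / 4))) ->
        exists C : R, forall n, (0 < n)%N ->
          (kolmogorov_dist
             (cw_cdf (beta n)
                (fun x : config n =>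
                   Num.sqrt (1 - beta n) * spin_sum x / Num.sqrt n%:R)%R)
             Phi
           <= (C * n%:R `^ (- (1 / 2)))%:E)%E)].
Proof.
have near_gt0 : \forall n \near \oo, (0 < n)%N by exact: nbhs_infty_gt.
have crit01 (b z : R) : 0 <= density_cdf (quartic_density (1 / 12) b) z <= 1.
  exact: density_cdf01 (subgaussian_critical (normr_ge0 b) (lexx _)).
have ll_sqrt : seq_ll (fun n => `|beta n - 1|) (fun n => n%:R `^ (- (1 / 2))) ->
    `|(beta n - 1) * Num.sqrt n%:R| @[n --> \oo] --> (0 : R).
  rewrite /seq_ll (_ : (fun n => _ / _) = fun n => `|(beta n - 1) * Num.sqrt n%:R|)//.
  by apply/funext => n; rewrite div_powR_half normrM [`|Num.sqrt _|]ger0_norm.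
split.
- move=> gamma _ hgamma.
  have [C C0 hC] := kolmogorov_critical (normr_ge0 gamma) (lexx `|gamma|).
  rewrite F_quarticE; apply: (@near_bound_all _ _ C).
    by move=> n n0; apply: kolmogorov_dist_le1; exact: crit01.
  near=> n.
  have n0 : (0 < n)%N by near: n.
  have bn : (beta n - 1) * Num.sqrt n%:R = gamma.
    have -> : beta n - 1 = gamma / Num.sqrt n%:R by near: n.
    by rewrite divfK// gt_eqF// (lt_le_trans ltr01)// sqrt_nat_ge1.
  have := hC n (beta n) n0; rewrite bn lexx => /(_ isT).
  by rewrite subrr normr0 add0r.
- rewrite F_criticalE; split.
    move=> /ll_sqrt e0 z _.
    have [C C0 hC] := @kolmogorov_critical R 1 0 ler01 ltac:(by rewrite normr0).
    apply: (@cvg_of_kolmogorov _ (fun n => cw_cdf (beta n)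
        (fun x : config n => spin_sum x / n%:R `^ (3 / 4))) _
        (fun n => C * (`|(beta n - 1) * Num.sqrt n%:R| + (Num.sqrt n%:R)^-1))); last first.
      rewrite -(mulr0 C) -(addr0 (0 : R)); apply: cvgMr; apply: cvgD => //.
      exact: cvg_inv_sqrt.
    near=> n.
    have n0 : (0 < n)%N by near: n.
    have := hC n (beta n) n0; rewrite subr0; apply.
    by near: n; exact: (cvgr_le _ e0 _ ltr01).
  move=> /eqO_exP [k /= k0 hk].
  have [C C0 hC] := @kolmogorov_critical R k 0 (ltW k0) ltac:(by rewrite normr0 ltW).
  apply: (@near_bound_all _ _ (C * (k + 1))).
    by move=> n n0; apply: kolmogorov_dist_le1; exact: crit01.
  near=> n.
  have n0 : (0 < n)%N by near: n.
  have r1 := @sqrt_nat_ge1 R _ n0.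
  have r0 := lt_le_trans ltr01 r1.
  have bk : `|(beta n - 1) * Num.sqrt n%:R| <= k * (Num.sqrt n%:R)^-1.
    have : `| `|beta n - 1| | <= k * `|n%:R^-1 : R| by near: n.
    rewrite normr_id [`|_^-1|]ger0_norm ?invr_ge0// => hn.
    rewrite normrM [`|Num.sqrt _|]ger0_norm// -ler_pdivlMr//.
    apply: le_trans hn _; rewrite -[in leLHS](@natr_sqrt_sqr R n).
    by rewrite -mulrA -invfM -expr2.
  have := hC n (beta n) n0; rewrite subr0 => /(_ _)/le_trans; apply.
    by apply: le_trans bk _; rewrite ler_pdivrMr// ler_peMr// ltW.
  by rewrite lee_fin -[leRHS]mulrA ler_wpM2l// [leRHS]mulrDl mul1r lerD2r.
- move=> beta_lt1.
  have [C C0 hC] := @kolmogorov_normal R.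
  have Phi01 n (f : config n -> R) : (kolmogorov_dist (cw_cdf (beta n) f) Phi <= 1)%E.
    rewrite (_ : Phi = fun z => (density_cdf (quartic_density 0 (-1 : R)) z)%:E).
      apply: kolmogorov_dist_le1 => z; apply: density_cdf01.
      exact: subgaussian_normal (lexx _).
    by apply/funext => z; exact: PhiE.
  split.
    move=> gg.
    have mE : (fun n => `|beta n - 1| / n%:R `^ (- (1 / 2))) =
        (fun n => `|(1 - beta n) * Num.sqrt n%:R|).
      by apply/funext => n; rewrite div_powR_half normrM distrC [`|Num.sqrt _|]ger0_norm.
    rewrite /seq_gg mE in gg.
    apply: (@near_cvg0 _ _ C (fun n => (Num.sqrt n%:R)^-1 +
      `|(1 - beta n) * Num.sqrt n%:R| ^- 2)).
    + by move=> n; exact: kolmogorov_dist_ge0.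
    + near=> n.
      have n0 : (0 < n)%N by near: n.
      have b1 := beta_lt1 n n0.
      have e0 : 0 < 1 - beta n by rewrite subr_gt0.
      have mm : `|(1 - beta n) * Num.sqrt n%:R| = (1 - beta n) * Num.sqrt n%:R.
        by rewrite ger0_norm// mulr_ge0// ltW.
      have hn := hC n (beta n) n0; rewrite -mm in hn; move: hn.
      rewrite (_ : (fun x : config n => spin_sum x / Num.sqrt (n%:R / (1 - beta n))) =
        (fun x : config n => Num.sqrt ((1 - beta n) / n%:R) * spin_sum x)).
        apply; first by rewrite beta_gt0.
        by near: n; move/cvgryPge : gg; apply.
      apply/funext => x; rewrite mulrC; congr (_ * _).
      by rewrite -sqrtrV ?divr_ge0 ?(ltW e0)// invf_div.
    + rewrite -(addr0 (0 : R)); apply: cvgD; first exact: cvg_inv_sqrt.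
      apply/gtr0_cvgV0.
        near=> n; rewrite exprn_gt0//; apply: (lt_le_trans ltr01).
        by near: n; move/cvgryPge : gg; apply.
      apply/cvgryPge => A; near=> n.
      have mA : Num.max 1 A <= `|(1 - beta n) * Num.sqrt n%:R|.
        by near: n; move/cvgryPge : gg; apply.
      move: mA; rewrite ge_max => /andP[m1 mA]; apply: le_trans mA _.
      by rewrite expr2 ler_peMr// (le_trans ler01).
  move=> gg; apply: (@near_bound_all _ _ (2 * C)) => [n n0|]; first exact: Phi01.
  near=> n.
  have n0 : (0 < n)%N by near: n.
  have r1 := @sqrt_nat_ge1 R _ n0.
  have r0 := lt_le_trans ltr01 r1.
  have b1 := beta_lt1 n n0.
  have e0 : 0 < 1 - beta n by rewrite subr_gt0.
  have nR : 0 < n%:R :> R by rewrite ltr0n.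
  have q1 : 1 <= `|beta n - 1| / n%:R `^ (- (1 / 4)).
    by near: n; move/cvgryPge : gg; apply.
  (* (1 - beta) >= n^(-1/4) makes m^2 = (1 - beta)^2 n at least sqrt n. *)
  have q2 : Num.sqrt n%:R <= ((1 - beta n) * Num.sqrt n%:R) ^+ 2.
    move: q1; rewrite distrC (gtr0_norm e0) powRN invrK => q1.
    have : 1 ^+ 2 <= ((1 - beta n) * n%:R `^ (1 / 4)) ^+ 2.
      by rewrite lerXn2r ?nnegrE ?(le_trans ler01 q1).
    rewrite expr1n !exprMn -[(_ `^ _) ^+ 2]powR_mulrn ?powR_ge0// -powRrM.
    have -> : 1 / 4 * 2 = 2^-1 :> R by field.
    rewrite powR12_sqrt// [X in _ -> _ <= _ * X]expr2 mulrA => h.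
    by rewrite ler_peMl// ltW.
  have q3 : 1 <= (1 - beta n) * Num.sqrt n%:R.
    rewrite -(@ler_pXn2r _ 2)// ?nnegrE ?mulr_ge0 ?(ltW e0)//.
    by rewrite expr1n (le_trans r1).
  have := hC n (beta n) n0 _ q3.
  rewrite (_ : (fun x : config n => spin_sum x / Num.sqrt (n%:R / (1 - beta n))) =
    (fun x : config n => Num.sqrt (1 - beta n) * spin_sum x / Num.sqrt n%:R)).
    move=> /(_ _)/le_trans; apply; first by rewrite beta_gt0.
    rewrite lee_fin [leRHS](_ : _ = C * (2 * (Num.sqrt n%:R)^-1)); last by ring.
    rewrite ler_wpM2l//.
    have : ((1 - beta n) * Num.sqrt n%:R) ^- 2 <= (Num.sqrt n%:R)^-1.
      by rewrite lef_pV2 ?posrE ?exprn_gt0 ?mulr_gt0.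
    lra.
  apply/funext => x; rewrite [RHS]mulrAC mulrC; congr (_ * _).
  rewrite -sqrtrV ?divr_ge0 ?(ltW e0)// invf_div sqrtrM ?(ltW e0)//.
  by rewrite sqrtrV.
Unshelve. all: by end_near. Qed.
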